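(* Let $N\ge 1$ and $m\ge 3$ be integers. If $\mathfrak P$ is a bounded convex polytope in $\mathbb R^N$ with $m$ facets and $n$ vertices, then \[ n\le \Lambda(N,m):=2\,h_{111}(m-1)\ \vee\ \big(h_{111}(m)+h_{221}(m-1)\big). \]
   Context: Notation: $a\vee b=\max\{a,b\}$, $a\wedge b=\min\{a,b\}$; binomial coefficients $\binom{a}{b}$ are taken to be $0$ when $b<0$ or $b>a$. Define $h_1(m,r):=\binom{m-r}{r}$ and $h_2(m,r):=\binom{m-r}{r-1}$, and \[ r_{11}(m)=\frac{5m-3-\sqrt{5m^2+10m+9}}{10},\qquad r_{21}(m)=\frac{5m+2-\sqrt{5m^2+4}}{10}. \] For $i,j\in\{1,2\}$ set \[ h_{ij1}(m):=h_i\big(m,\lfloor r_{j1}(m)\rfloor\wedge\lfloor N/2\rfloor\big)\ \vee\ h_i\big(m,\lceil r_{j1}(m)\rceil\wedge\lfloor N/2\rfloor\big) \] (so $h_{111}$ uses $h_1$ and $r_{11}$, and $h_{221}$ uses $h_2$ and $r_{21}$). A facet is a face of codimension one. *)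

(* Defs.v *)
From HB Require Import structures.
From mathcomp Require Import all_boot all_order all_algebra.
From mathcomp Require Import boolp classical_sets reals.
Set Implicit Arguments.
Unset Strict Implicit.
Unset Printing Implicit Defensive.
Import Order.TTheory GRing.Theory Num.Theory.
Local Open Scope classical_set_scope.
Local Open Scope ring_scope.

Section Geometry.
Variables (R : realType) (N : nat).
Local Notation V := 'rV[R]_N.

Definition dotp (a x : V) : R := \sum_(i < N) a 0 i * x 0 i.

Definition conv_hull (k : nat) (v : 'I_k -> V) : set V :=
  [set x | exists c : 'I_k -> R, (forall i, 0 <= c i) /\
     \sum_(i < k) c i = 1 /\ x = \sum_(i < k) c i *: v i].

Definition polytope (P : set V) : Prop :=
  exists k (v : 'I_k -> V), P = conv_hull v.

(* faces: intersections of P with a supporting hyperplane (a weak one, so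
   that P itself (a = 0, b = 0) and the empty face are included) *)
Definition face (P F : set V) : Prop :=
  exists (a : V) (b : R), (forall x, P x -> dotp a x <= b) /\
    F = P `&` [set x | dotp a x = b].

Definition aff_indep (k : nat) (p : 'I_k.+1 -> V) : bool :=
  row_free (\matrix_(i < k) (p (lift ord0 i) - p ord0)).

Definition affdim_ge (S : set V) (k : nat) : Prop :=
  exists p : 'I_k.+1 -> V, (forall i, S (p i)) /\ aff_indep p.

Definition affdim_eq (S : set V) (d : nat) : Prop :=
  affdim_ge S d /\ ~ affdim_ge S d.+1.

Definition facet (P F : set V) : Prop :=
  face P F /\ exists d : nat, affdim_eq P d.+1 /\ affdim_eq F d.

Definition vertex (P : set V) (x : V) : Prop := face P [set x].

Definition num_facets (P : set V) (m : nat) : Prop :=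
  exists f : 'I_m -> set V, injective f /\ (forall i, facet P (f i)) /\
    (forall F, facet P F -> exists i, F = f i).

Definition num_vertices (P : set V) (n : nat) : Prop :=
  exists v : 'I_n -> V, injective v /\ (forall i, vertex P (v i)) /\
    (forall x, vertex P x -> exists i, x = v i).

End Geometry.

Definition binZ (a b : int) : nat :=
  if (0 <= b) && (b <= a) then 'C(`|a|%N, `|b|%N) else 0%N.

Definition h1 (m : nat) (r : int) : nat := binZ (m%:Z - r) r.
Definition h2 (m : nat) (r : int) : nat := binZ (m%:Z - r) (r - 1).

Section Lambda.
Variable R : realType.

Definition r11 (m : nat) : R :=
  (5 * m%:R - 3 - Num.sqrt (5 * m%:R ^+ 2 + 10 * m%:R + 9)) / 10.
Definition r21 (m : nat) : R :=
  (5 * m%:R + 2 - Num.sqrt (5 * m%:R ^+ 2 + 4)) / 10.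

Definition hij1 (h : nat -> int -> nat) (rj : nat -> R) (N m : nat) : nat :=
  maxn (h m (Num.min (Num.floor (rj m)) (N./2)%:Z))
       (h m (Num.min (Num.ceil (rj m)) (N./2)%:Z)).

Definition h111 (N m : nat) : nat := hij1 h1 r11 N m.
Definition h221 (N m : nat) : nat := hij1 h2 r21 N m.

Definition Lambda (N m : nat) : nat :=
  maxn (2 * h111 N m.-1) (h111 N m + h221 N m.-1).
End Lambda.

(* Main.v *)
Require Import Defs.
From mathcomp Require Import all_boot all_order all_algebra.
From mathcomp Require Import boolp reals.
From mathcomp Require Import zify ring lra.
Set Implicit Arguments.
Unset Strict Implicit.
Unset Printing Implicit Defensive.

(** McMullen's upper bound argument, run on linear programming bases. In affine
    coordinates on its affine hull, of dimension [d], the polytope is described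
    by [m] facet inequalities [A x <= b]; facets suffice because every valid
    inequality is a nonnegative combination of facet inequalities. For a generic
    right-hand side near [b] each vertex of the polytope still yields at least
    one feasible basis, distinct vertices yielding distinct bases, so it is
    enough to count feasible bases [B]. For a generic objective [c] let [h_i] be
    the number of those whose dual solution has [i] negative entries. Every
    nonempty face has a unique maximal vertex, so the [h_i] are determined by the
    numbers of faces and do not depend on [c]. Replacing [c] by [- c] gives
    [h_i = h_(d-i)], and choosing objectives that are maximal on a given facet
    gives [(d - i) h_i + (i + 1) h_(i+1) <= m h_i], whence
    [h_i <= 'C(m - d - 1 + i, i)]. Summing yields the classical upper bound, and
    the functions of [d] so obtained are unimodal with maximum next to [r11] and
    [r21]. *)

(** * The h-vector of a family of sets *)

Section SinkOrientations.
Variable T : finType.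
Implicit Types (V : {set {set T}}) (B S : {set T}) (neg : {set T} -> {set T}).

Definition uniform d V := forall B, B \in V -> #|B| = d.

(* [V] encodes the vertices of a simple polytope by their sets of tight facets,
   and [neg B] the facets whose edge out of the vertex (all other tight facets
   being kept) increases a linear objective. The second condition says that every nonempty face,
   encoded by a set [S] of facets, has a unique objective-maximal vertex;
   [hnum V neg] is then the h-vector. *)
Definition sink_orientation V neg :=
  (forall B, B \in V -> neg B \subset B) /\
  (forall B S, B \in V -> S \subset B ->
     #|[set C in V | (neg C \subset S) && (S \subset C)]| = 1).

Definition hnum V neg i := #|[set B in V | #|neg B| == i]|.

(** The facet [j] as a simple polytope in its own right, with [j] dropped from the tight sets;
    [link_neg] restricts the orientation to it. *)
Definition link (j : T) V := [set B :\ j | B in V & j \in B].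
Definition link_neg (j : T) neg B := neg (j |: B) :\ j.

Lemma card_set_sum (U : finType) (P : pred U) : #|[set x | P x]| = \sum_x P x.
Proof. by rewrite -sum1dep_card [LHS]big_mkcond; apply: eq_bigr => x _; case: (P x). Qed.

Lemma card_interval_size (X Y : {set T}) s : X \subset Y ->
  #|[set S : {set T} | [&& X \subset S, S \subset Y & #|S| == s]]| =
  if #|X| <= s then 'C(#|Y| - #|X|, s - #|X|) else 0.
Proof.
move=> XY; case: leqP => [Xs|sX]; last first.
  apply/eqP; rewrite cards_eq0; apply/eqP/setP => S; rewrite !inE.
  apply/negP => /and3P[XS _ /eqP sS]; have := subset_leq_card XS; lia.
rewrite -(cardsDS XY) -cards_draws.
rewrite -[LHS](@card_in_imset _ _ (fun S => S :\: X)); last first.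
  move=> S1 S2; rewrite !inE => /and3P[X1 _ _] /and3P[X2 _ _] e.
  by rewrite -(setID S1 X) -(setID S2 X) e (setIidPr X1) (setIidPr X2).
apply: eq_card => S; apply/imsetP/idP => [[S' + ->]|]; rewrite !inE.
  move=> /and3P[XS SY /eqP <-]; rewrite setSD //= cardsDS //.
rewrite subsetD => /andP[/andP[SY dSX] /eqP sS].
exists (X :|: S); last by rewrite setDUl setDv set0U; apply/esym/setDidPl.
rewrite !inE subsetUl subUset XY SY /= cardsU sS.
have -> : X :&: S = set0 by apply/eqP; rewrite setI_eq0 disjoint_sym.
by rewrite cards0; apply/eqP; lia.
Qed.

Lemma hnum_sum V neg (F : nat -> nat) n : (forall B, B \in V -> #|neg B| < n) ->
  \sum_(B in V) F #|neg B| = \sum_(i < n) hnum V neg i * F i.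
Proof.
move=> ltn.
transitivity (\sum_(B in V) \sum_(i < n) (#|neg B| == i) * F i).
  apply: eq_bigr => B BV; rewrite (bigD1 (Ordinal (ltn _ BV))) //= eqxx mul1n.
  rewrite big1 ?addn0 // => i ni; case: eqP => // e; case/eqP: ni; exact: val_inj.
rewrite exchange_big; apply: eq_bigr => i _; rewrite -big_distrl /=; congr (_ * _).
rewrite /hnum card_set_sum big_mkcond /=; apply: eq_bigr => B _.
by case: (B \in V).
Qed.

(** Double counting of pairs [neg B \subset S \subset B] with [#|S| = s]: the sink condition allots
    one [B] to each face [S], while a [B] with [#|neg B| = i] admits ['C(d - i, s - i)] sets [S]. *)
Lemma face_count d V neg s : uniform d V -> sink_orientation V neg ->
  \sum_(i < d.+1) hnum V neg i * (if i <= s then 'C(d - i, s - i) else 0) =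
  #|[set S : {set T} | (#|S| == s) && [exists B in V, S \subset B]]|.
Proof.
move=> uV [negB sink].
rewrite -(@hnum_sum V neg (fun i => if i <= s then 'C(d - i, s - i) else 0) d.+1); last first.
  by move=> B BV; rewrite ltnS -(uV _ BV) subset_leq_card // negB.
transitivity (\sum_(B in V) \sum_(S : {set T})
    [&& neg B \subset S, S \subset B & #|S| == s] : nat).
  by apply: eq_bigr => B BV; rewrite -(uV _ BV) -card_interval_size ?negB // card_set_sum.
rewrite exchange_big /= card_set_sum; apply: eq_bigr => S _.
case: (#|S| == s); last by rewrite big1 //= => B _; rewrite !andbF.
case: existsP => [[B /andP[BV SB]]|ex] /=.
  rewrite -[RHS](sink B S BV SB) card_set_sum big_mkcond; apply: eq_bigr => C _.
  by rewrite andbT; case: (C \in V).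
rewrite big1 // => B BV; case SB: (S \subset B); last by rewrite andbF.
by case: ex; exists B; rewrite BV.
Qed.

(* The face counts do not depend on [neg], and [face_count] is a unitriangular
   system for the numbers [hnum]. *)
Lemma hnum_indep d V neg neg' i : uniform d V ->
  sink_orientation V neg -> sink_orientation V neg' ->
  hnum V neg i = hnum V neg' i.
Proof.
move=> uV sn sn'.
have [lid|ltdi] := leqP i d; last first.
  have h0 g : sink_orientation V g -> hnum V g i = 0.
    move=> [gB _]; apply/eqP; rewrite cards_eq0; apply/eqP/setP => B; rewrite !inE.
    apply/negP => /andP[BV /eqP e].
    by have := subset_leq_card (gB _ BV); rewrite (uV _ BV) e; lia.
  by rewrite !h0.
elim/ltn_ind: i lid => s IH lsd.
have := face_count s uV sn; rewrite -(face_count s uV sn').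
have lsd1 : s < d.+1 by [].
rewrite (bigD1 (Ordinal lsd1)) //= [RHS](bigD1 (Ordinal lsd1)) //=.
rewrite leqnn subnn bin0 !muln1.
set x := \sum_(_ | _) _; set y := \sum_(_ | _) _.
suff -> : x = y by move/addIn.
apply: eq_bigr => j /negP nj; case: leqP => [ljs|_]; last by rewrite !muln0.
rewrite IH //; last by rewrite -ltnS.
rewrite ltn_neqAle ljs andbT; apply/negP => /eqP e; apply: nj; apply/eqP; exact: val_inj.
Qed.

Lemma link_uniform d V j : uniform d.+1 V -> uniform d (link j V).
Proof.
move=> uV B /imsetP[C]; rewrite inE => /andP[CV jC] ->.
by have := uV _ CV; rewrite (cardsD1 j) jC => -[].
Qed.

Lemma mem_link V j B : (B \in link j V) = (j \notin B) && ((j |: B) \in V).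
Proof.
apply/imsetP/andP => [[C]|[jB BV]].
  by rewrite inE => /andP[CV jC] ->; rewrite !inE eqxx setD1K.
by exists (j |: B); rewrite ?inE ?eqxx ?BV // setU1K.
Qed.

Lemma link_sink V neg j : sink_orientation V neg ->
  sink_orientation (link j V) (link_neg j neg).
Proof.
move=> [negB sink]; split=> [B|B S].
  rewrite mem_link => /andP[jB BV]; rewrite /link_neg subDset.
  by rewrite (subset_trans (negB _ BV)).
rewrite mem_link => /andP[jB BV] SB.
rewrite -[RHS](sink (j |: B) (j |: S) BV (setUS _ SB)).
have jS : j \notin S by apply: contra jB; apply/subsetP.
rewrite -[RHS](@card_in_imset _ _ (fun C => C :\ j)); last first.
  move=> C1 C2; rewrite !inE => /and3P[_ _ s1] /and3P[_ _ s2] e.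
  have j1 : j \in C1 by apply: (subsetP s1); rewrite setU11.
  have j2 : j \in C2 by apply: (subsetP s2); rewrite setU11.
  by rewrite -(setD1K j1) -(setD1K j2) e.
apply: eq_card => C; rewrite inE mem_link; apply/idP/imsetP.
  move=> /and3P[/andP[jC CV] nS SC]; exists (j |: C); last by rewrite setU1K.
  by rewrite inE CV setUS // andbT /= -subDset.
move=> [D]; rewrite inE => /and3P[DV nS SD] ->.
have jD : j \in D by apply: (subsetP SD); rewrite setU11.
rewrite /link_neg setD1K // !inE eqxx DV /= subDset nS /=.
by apply/subsetP => x xS; rewrite !inE (subsetP SD) ?inE ?xS ?orbT // andbT;
   apply: contraNneq jS => <-.
Qed.

Lemma hnum_linkE V neg j i :
  hnum (link j V) (link_neg j neg) i =
  #|[set B in V | (j \in B) && (#|neg B :\ j| == i)]|.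
Proof.
rewrite /hnum -[LHS](@card_in_imset _ _ (fun C => j |: C)); last first.
  move=> C1 C2; rewrite !inE !mem_link => /andP[/andP[j1 _] _] /andP[/andP[j2 _] _] e.
  by rewrite -(setU1K j1) -(setU1K j2) e.
apply: eq_card => B; apply/imsetP/idP => [[C + ->]|]; rewrite !inE ?mem_link.
  by move=> /andP[/andP[jC ->] h]; rewrite eqxx.
move=> /and3P[BV jB h]; exists (B :\ j); last by rewrite setD1K.
by rewrite inE mem_link !inE eqxx /link_neg setD1K // BV.
Qed.

(** Removing [j \in B] leaves [i] negative elements either when [#|neg B| = i] and [j \notin neg B],
    with [d - i] choices of [j], or when [#|neg B| = i.+1] and [j \in neg B], with [i.+1]
    choices. *)
Lemma sum_hnum_link d V neg i : uniform d V -> sink_orientation V neg ->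
  \sum_j hnum (link j V) (link_neg j neg) i =
  (d - i) * hnum V neg i + i.+1 * hnum V neg i.+1.
Proof.
move=> uV [negB _].
under eq_bigr => j _ do rewrite hnum_linkE card_set_sum.
rewrite exchange_big /= /hnum !card_set_sum !big_distrr -big_split /=.
apply: eq_bigr => B _; case: (boolP (B \in V)) => [BV|_]; last first.
  by rewrite big1 // !muln0.
have sB := negB _ BV.
rewrite /= -[LHS]card_set_sum.
have [e|ni] := eqVneq #|neg B| i.
  have -> : (#|neg B| == i.+1) = false by apply/eqP; lia.
  rewrite muln0 addn0 muln1 -e -(uV _ BV) -cardsDS //.
  apply: eq_card => j; rewrite !inE andbC; congr (_ && _).
  have := cardsD1 j (neg B); case: (j \in neg B) => /= h; lia.
rewrite muln0 add0n.
have [e|ni1] := eqVneq #|neg B| i.+1.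
  rewrite muln1 -e; apply: eq_card => j; rewrite !inE.
  have := cardsD1 j (neg B); case: (boolP (j \in neg B)) => /= jn h.
    rewrite (subsetP sB) //=; lia.
  by apply/negP => /andP[_ /eqP]; lia.
rewrite muln0; apply/eqP; rewrite cards_eq0; apply/eqP/setP => j; rewrite !inE.
apply/negP => /andP[_ /eqP].
by have := cardsD1 j (neg B); case: (j \in neg B) => /=; lia.
Qed.

Lemma hnum0 V neg B : B \in V -> sink_orientation V neg -> hnum V neg 0 = 1.
Proof.
move=> BV [_ /(_ _ _ BV (sub0set B)) <-]; apply: eq_card => C; rewrite !inE.
by rewrite subset0 sub0set andbT cards_eq0.
Qed.

(** Under an objective maximal on the facet [j], no improving edge leaves [j], so [hnum] of the link
    counts a subset of what [hnum] of [V] counts. By [hnum_indep] the inequality holds for every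
    objective; it is then summed over [j] by [sum_hnum_link]. *)
Lemma hnum_rec d V neg i : uniform d V -> sink_orientation V neg ->
  (forall j, exists2 neg', sink_orientation V neg' &
     forall B, B \in V -> j \in B -> j \notin neg' B) ->
  i <= d ->
  i.+1 * hnum V neg i.+1 <= (#|T| - d + i) * hnum V neg i.
Proof.
move=> uV sn top lid.
(* A nonempty [V] forces [d <= #|T|], which makes [#|T| - d] a genuine difference. *)
have [->|/set0Pn[B0 B0V]] := eqVneq V set0.
  have h0 k : hnum set0 neg k = 0 by apply: eq_card0 => B; rewrite !inE.
  by rewrite !h0 muln0.
have ldT : d <= #|T| by rewrite -(uV _ B0V) max_card.
case: d uV lid ldT => [|d] uV lid ldT.
  have h0 : hnum V neg i.+1 = 0.
    apply: eq_card0 => B; rewrite !inE; apply/negP => /andP[BV /eqP e].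
    by have := subset_leq_card (sn.1 _ BV); rewrite (uV _ BV) e.
  by rewrite h0 muln0.
suff le : \sum_j hnum (link j V) (link_neg j neg) i <= #|T| * hnum V neg i.
  move: le; rewrite (sum_hnum_link _ uV sn).
  rewrite (_ : #|T| = d.+1 - i + (#|T| - d.+1 + i)) ?[X in _ <= X]mulnDl; last by lia.
  rewrite leq_add2l.
  by rewrite (_ : d.+1 - i + _ - d.+1 + i = #|T| - d.+1 + i) //; lia.
rewrite -sum_nat_const; apply: leq_sum => j _.
have [neg' sn' jn] := top j.
rewrite (hnum_indep i (link_uniform uV) (link_sink j sn) (link_sink j sn')).
rewrite (hnum_indep i uV sn sn') hnum_linkE; apply: subset_leq_card.
apply/subsetP => B; rewrite !inE => /and3P[BV jB].
by rewrite BV (cardsD1 j (neg' B)) (negbTE (jn _ BV jB)).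
Qed.

(** Here the factor in [hnum_rec] is [(e + i).+1], and ['C(e + i, i)] satisfies that recursion with
    equality. *)
Lemma hnum_le d e V neg i : uniform d V -> sink_orientation V neg ->
  (forall j, exists2 neg', sink_orientation V neg' &
     forall B, B \in V -> j \in B -> j \notin neg' B) ->
  V != set0 -> #|T| = d.+1 + e -> i <= d ->
  hnum V neg i <= 'C(e + i, i).
Proof.
move=> uV sn top /set0Pn[B BV] cT.
elim: i => [|i IH] lid; first by rewrite (hnum0 BV) // bin0.
rewrite -(leq_pmul2l (ltn0Sn i)).
apply: leq_trans (hnum_rec uV sn top (ltnW lid)) _.
rewrite cT (_ : d.+1 + e - d + i = (e + i).+1) ?addnS; last by lia.
by rewrite -mul_bin_diag leq_mul2l IH ?orbT // ltnW.
Qed.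

Lemma hnum_compl d V neg i : uniform d V -> sink_orientation V neg -> i <= d ->
  hnum V neg (d - i) = hnum V (fun B => B :\: neg B) i.
Proof.
move=> uV [negB _] lid; apply: eq_card => B; rewrite !inE.
case: (boolP (B \in V)) => //= BV; rewrite cardsDS ?negB // (uV _ BV).
by have := subset_leq_card (negB _ BV); rewrite (uV _ BV) => ?; apply/eqP/eqP; lia.
Qed.

Lemma sum_bin_diag e k : \sum_(i < k.+1) 'C(e + i, i) = 'C(e + k.+1, k).
Proof.
elim: k => [|k IH]; first by rewrite big_ord_recr big_ord0 /= !bin0.
by rewrite big_ord_recr /= IH !addnS [RHS]binS addnC -addnS.
Qed.

(** If [#|T| = d], the recursion starts with the factor [0] and kills every [hnum V neg i] with
    [0 < i <= d]; yet the one at [d] equals that of the reversed orientation at [0], which is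
    [1]. *)
Lemma dim_lt_ground d V neg : 0 < d -> uniform d V -> sink_orientation V neg ->
  sink_orientation V (fun B => B :\: neg B) ->
  (forall j, exists2 neg', sink_orientation V neg' &
     forall B, B \in V -> j \in B -> j \notin neg' B) ->
  V != set0 -> d < #|T|.
Proof.
move=> d0 uV sn sn' top /set0Pn[B0 BV].
have ldT : d <= #|T| by rewrite -(uV _ BV) max_card.
rewrite ltn_neqAle ldT andbT; apply/negP => /eqP e.
have h0 i : i < d -> hnum V neg i.+1 = 0.
  elim: i => [|i IH] lid; have := hnum_rec uV sn top (ltnW lid).
    by rewrite -e subnn mul0n mul1n leqn0 => /eqP.
  by rewrite (IH (ltnW lid)) muln0 leqn0 muln_eq0 => /eqP.
have := hnum_compl uV sn (leq0n d); rewrite (hnum0 BV sn') subn0.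
by rewrite -(prednK d0) h0 // prednK.
Qed.

(** [hnum_le] is applied directly for [i <= d./2]; the other indices are reflected by [hnum_compl]
    and bounded for the reversed orientation. *)
Lemma upper_bound d e V neg : uniform d V -> sink_orientation V neg ->
  sink_orientation V (fun B => B :\: neg B) ->
  (forall j, exists2 neg', sink_orientation V neg' &
     forall B, B \in V -> j \in B -> j \notin neg' B) ->
  V != set0 -> #|T| = d.+1 + e ->
  #|V| <= (\sum_(i < d./2.+1) 'C(e + i, i)) + \sum_(i < uphalf d) 'C(e + i, i).
Proof.
move=> uV sn sn' top V0 cT.
have -> : #|V| = \sum_(i < d.+1) hnum V neg i.
  rewrite -sum1_card (@hnum_sum V neg (fun=> 1) d.+1).
    by apply: eq_bigr => i _; rewrite muln1.
  by move=> B BV; rewrite ltnS -(uV _ BV) subset_leq_card // sn.1.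
have dE : d = d./2 + uphalf d by rewrite addnC uphalf_half -addnA addnn odd_double_half.
have -> : d.+1 = d./2.+1 + uphalf d by rewrite addSn -dE.
rewrite big_split_ord /=; apply: leq_add.
  by apply: leq_sum => i _; apply: (hnum_le uV) => //; have := ltn_ord i; lia.
rewrite (reindex_inj rev_ord_inj); apply: leq_sum => i _.
have := ltn_ord i => lti.
rewrite (_ : (_ + _)%N = d - i) /=; last by lia.
have lid : i <= d by lia.
by rewrite (hnum_compl uV sn lid); apply: (hnum_le uV).
Qed.
End SinkOrientations.

Import Order.TTheory GRing.Theory Num.Theory.
Local Open Scope ring_scope.

(** * Unimodality of the binomial bounds *)

(** With [m = 2r + 2 + e] the two binomials are consecutive values of [h1 m], with [m = 2r + 3 + e]
    consecutive values of [h2 m]. Comparing them is a quadratic inequality in the argument, with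
    smaller root [r11 m], respectively [r21 m]. *)
Lemma bin_shift_ratio e r :
  ('C((e + r).+1, r.+1) * (r.+1 * (e + r).+2) = 'C((e + r).+2, r) * (e.+2 * e.+1))%N.
Proof.
have h2 := mul_bin_left (e + r).+1 r.
have h3 := mul_bin_down (e + r).+2 r.
rewrite (_ : (e + r).+1 - r = e.+1)%N in h2; last by lia.
rewrite (_ : (e + r).+2 - r = e.+2)%N /= in h3; last by lia.
by rewrite mulnA [('C(_, _) * _)%N]mulnC h2 -mulnA
  [('C((e + r).+1, r) * _)%N]mulnC h3 mulnCA mulnA mulnC.
Qed.

Lemma le_of_steps (f : nat -> nat) a b : (a <= b)%N ->
  (forall r, (a <= r < b)%N -> (f r <= f r.+1)%N) -> (f a <= f b)%N.
Proof.
elim: b => [|b IH]; first by rewrite leqn0 => /eqP ->.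
rewrite leq_eqVlt => /predU1P[->//|]; rewrite ltnS => ab st.
apply: leq_trans (st b _); last by rewrite ab ltnSn.
by apply: IH => // r /andP[ar rb]; apply: st; rewrite ar ltnS ltnW.
Qed.

Lemma ge_of_steps (f : nat -> nat) a b : (a <= b)%N ->
  (forall r, (a <= r < b)%N -> (f r.+1 <= f r)%N) -> (f b <= f a)%N.
Proof.
elim: b => [|b IH]; first by rewrite leqn0 => /eqP ->.
rewrite leq_eqVlt => /predU1P[->//|]; rewrite ltnS => ab st.
apply: leq_trans (st b _) _; first by rewrite ab ltnSn.
by apply: IH => // r /andP[ar rb]; apply: st; rewrite ar ltnS ltnW.
Qed.

Lemma bin_shift_le e r : (r.+1 * (e + r).+2 <= e.+2 * e.+1)%N ->
  ('C((e + r).+2, r) <= 'C((e + r).+1, r.+1))%N.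
Proof.
move=> h; have := bin_shift_ratio e r => /esym E.
rewrite -(leq_pmul2r (_ : 0 < e.+2 * e.+1)%N) // E; exact: leq_mul.
Qed.

Lemma bin_shift_ge e r : (e.+2 * e.+1 <= r.+1 * (e + r).+2)%N ->
  ('C((e + r).+1, r.+1) <= 'C((e + r).+2, r))%N.
Proof.
move=> h; have E := bin_shift_ratio e r.
rewrite -(leq_pmul2r (_ : 0 < r.+1 * (e + r).+2)%N) // E; exact: leq_mul.
Qed.

Lemma minz_nat (a b : nat) : Num.min a%:Z b%:Z = (minn a b)%:Z.
Proof. by rewrite minEle lez_nat minnE; case: leqP => h; congr Posz; lia. Qed.

Section Unimodality.
Variable R : realType.

(** The hypothesis places [r] below the smaller root of [5 r^2 - (5 m - 3) r + m^2 - 2 m]. *)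
Lemma h1_step_up m r : (2 <= m)%N -> r%:R < r11 R m ->
  ('C(m - r, r) <= 'C(m - r.+1, r.+1))%N.
Proof.
move=> m2; rewrite /r11; set D := _ + 9; set s := Num.sqrt D.
have mR : 2 <= m%:R :> R by rewrite (ler_nat R 2).
have D0 : 0 <= D by rewrite /D; nra.
have sD : s ^+ 2 = D by rewrite sqr_sqrtr.
(* [7] is the value of [s] at [m = 2]; it gives [10 r < 5 m - 10], hence room for [e]. *)
have s7 : 7 <= s.
  by rewrite -(ler_pXn2r (_ : 0 < 2)%N) ?nnegrE ?sqrtr_ge0 // sD /D; nra.
rewrite ltr_pdivlMr // => h.
have {}m2 : (r.*2.+2 <= m)%N.
  rewrite -[X in (X <= _)%N]addn2 -addnn -(ler_nat R) !natrD; lra.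
have [e mE] : {e | m = (r.*2.+2 + e)%N} by exists (m - r.*2.+2)%N; lia.
have -> : (m - r = (e + r).+2)%N by lia.
have -> : (m - r.+1 = (e + r).+1)%N by lia.
apply: bin_shift_le; 
  rewrite -[r.+1]addn1 -[(e + r).+2]addn2 -[e.+2]addn2 -[e.+1]addn1 -(ler_nat R) !natrM !natrD.
have mRE : m%:R = 2 * r%:R + 2 + e%:R :> R.
  by rewrite mE -addnn -addn2 !natrD; ring.
have : s ^+ 2 <= (5 * m%:R - 3 - 10 * r%:R) ^+ 2.
  by rewrite ler_pXn2r ?nnegrE //; lra.
by rewrite sD /D mRE; lra.
Qed.

(** The first hypothesis keeps [r] left of the midpoint of the two roots, so the second places it
    between them. *)
Lemma h1_step_down m r : (r.*2.+2 <= m)%N -> r11 R m <= r%:R ->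
  ('C(m - r.+1, r.+1) <= 'C(m - r, r))%N.
Proof.
move=> m2; rewrite /r11; set D := _ + 9; set s := Num.sqrt D.
have mR : 0 <= m%:R :> R by rewrite ler0n.
have D0 : 0 <= D by rewrite /D; nra.
have sD : s ^+ 2 = D by rewrite sqr_sqrtr.
rewrite ler_pdivrMr // => h.
have [e mE] : {e | m = (r.*2.+2 + e)%N} by exists (m - r.*2.+2)%N; lia.
have -> : (m - r = (e + r).+2)%N by lia.
have -> : (m - r.+1 = (e + r).+1)%N by lia.
apply: bin_shift_ge; 
  rewrite -[r.+1]addn1 -[(e + r).+2]addn2 -[e.+2]addn2 -[e.+1]addn1 -(ler_nat R) !natrM !natrD.
have mRE : m%:R = 2 * r%:R + 2 + e%:R :> R.
  by rewrite mE -addnn -addn2 !natrD; ring.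
have e0 : 0 <= e%:R :> R by rewrite ler0n.
have : (5 * m%:R - 3 - 10 * r%:R) ^+ 2 <= s ^+ 2.
  by rewrite ler_pXn2r ?nnegrE ?sqrtr_ge0 //; lra.
by rewrite sD /D mRE; lra.
Qed.

(** The quadratic is now [5 x^2 - (5 m + 2) x + m^2 + m], where [x = r.+1] is the argument of
    [h2]. *)
Lemma h2_step_up m r : (1 <= m)%N -> r.+1%:R < r21 R m ->
  ('C(m - r.+1, r) <= 'C(m - r.+2, r.+1))%N.
Proof.
move=> m1; rewrite /r21; set D := _ + 4; set s := Num.sqrt D.
have mR : 1 <= m%:R :> R by rewrite (ler_nat R 1).
have D0 : 0 <= D by rewrite /D; nra.
have sD : s ^+ 2 = D by rewrite sqr_sqrtr.
have s3 : 3 <= s.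
  by rewrite -(ler_pXn2r (_ : 0 < 2)%N) ?nnegrE ?sqrtr_ge0 // sD /D; nra.
rewrite ltr_pdivlMr // => h.
have m2 : (r.*2.+3 <= m)%N.
  rewrite -addn1 natrD in h; rewrite -[X in (X < _)%N]addn2 -addnn -(ltr_nat R) !natrD; lra.
have [e mE] : {e | m = (r.*2.+3 + e)%N} by exists (m - r.*2.+3)%N; lia.
have -> : (m - r.+1 = (e + r).+2)%N by lia.
have -> : (m - r.+2 = (e + r).+1)%N by lia.
apply: bin_shift_le; 
  rewrite -[r.+1]addn1 -[(e + r).+2]addn2 -[e.+2]addn2 -[e.+1]addn1 -(ler_nat R) !natrM !natrD.
rewrite -addn1 natrD in h.
have mRE : m%:R = 2 * r%:R + 3 + e%:R :> R.
  by rewrite mE -addnn -addn3 !natrD; ring.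
have : s ^+ 2 <= (5 * m%:R + 2 - 10 * (r%:R + 1)) ^+ 2.
  by rewrite ler_pXn2r ?nnegrE //; lra.
by rewrite sD /D mRE; lra.
Qed.

Lemma h2_step_down m r : (r.*2.+3 <= m)%N -> r21 R m <= r.+1%:R ->
  ('C(m - r.+2, r.+1) <= 'C(m - r.+1, r))%N.
Proof.
move=> m2; rewrite /r21; set D := _ + 4; set s := Num.sqrt D.
have mR : 0 <= m%:R :> R by rewrite ler0n.
have D0 : 0 <= D by rewrite /D; nra.
have sD : s ^+ 2 = D by rewrite sqr_sqrtr.
rewrite ler_pdivrMr // -addn1 natrD => h.
have [e mE] : {e | m = (r.*2.+3 + e)%N} by exists (m - r.*2.+3)%N; lia.
have -> : (m - r.+1 = (e + r).+2)%N by lia.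
have -> : (m - r.+2 = (e + r).+1)%N by lia.
apply: bin_shift_ge; 
  rewrite -[r.+1]addn1 -[(e + r).+2]addn2 -[e.+2]addn2 -[e.+1]addn1 -(ler_nat R) !natrM !natrD.
have mRE : m%:R = 2 * r%:R + 3 + e%:R :> R.
  by rewrite mE -addnn -addn3 !natrD; ring.
have e0 : 0 <= e%:R :> R by rewrite ler0n.
have : (5 * m%:R + 2 - 10 * (r%:R + 1)) ^+ 2 <= s ^+ 2.
  by rewrite ler_pXn2r ?nnegrE ?sqrtr_ge0 //; lra.
by rewrite sD /D mRE; lra.
Qed.

Lemma h1_nat m j : (j <= m)%N -> h1 m j%:Z = 'C(m - j, j).
Proof.
move=> jm; rewrite /h1 /binZ subzn //=.
by rewrite lez_nat; case: leqP => // ?; rewrite bin_small.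
Qed.

Lemma h2_nat m j : (j < m)%N -> h2 m j.+1%:Z = 'C(m - j.+1, j).
Proof.
move=> jm; rewrite /h2 /binZ subzn // (_ : j.+1%:Z - 1 = j%:Z); last by lia.
by rewrite lez_nat /=; case: leqP => // ?; rewrite bin_small.
Qed.

(** The sequence rises up to the ceiling of [r11] and falls from there on, so its value at the
    ceiling capped by [N./2] bounds every admissible [k]. *)
Lemma h111_ge N m k : (2 <= m)%N -> (k.*2 <= m)%N -> (k <= N./2)%N ->
  ('C(m - k, k) <= h111 R N m)%N.
Proof.
move=> m2 km kN; rewrite /h111 /hij1 leq_max; apply/orP; right.
have mR : 2 <= m%:R :> R by rewrite (ler_nat R 2).
have /andP[r0 rm] : -1 < r11 R m <= m%:R.
  rewrite /r11; set D := _ + 9; have := sqrtr_ge0 D.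
  (* The bound [5 m + 6] suffices for [-1 < r11], which makes the ceiling a natural number. *)
  have : Num.sqrt D <= Num.sqrt ((5 * m%:R + 6) ^+ 2) by rewrite ler_wsqrtr // /D; nra.
  rewrite sqrtr_sqr ger0_norm; last by lra.
  by rewrite ltr_pdivlMr // ler_pdivrMr //; lra.
have: 0 <= Num.ceil (r11 R m) by rewrite Num.Theory.ceil_ge0.
case cE : (Num.ceil _) => [c|//] _.
have cm : (c <= m)%N by rewrite -lez_nat -cE Num.Theory.ceil_le_int.
rewrite minz_nat h1_nat; last by lia.
have [kj|jk] := leqP k (minn c N./2).
  apply: (@le_of_steps (fun r => 'C(m - r, r))%N) => // r /andP[_ rj].
  apply: h1_step_up => //.
  by rewrite pmulrn -Num.Theory.ceil_gt_int cE ltz_nat; lia.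
apply: (@ge_of_steps (fun r => 'C(m - r, r))%N); first exact: ltnW.
move=> r /andP[jr rk]; apply: h1_step_down; first by lia.
by rewrite pmulrn -Num.Theory.ceil_le_int cE lez_nat; lia.
Qed.

Lemma h221_ge N m k : (k.*2.+2 <= m)%N -> (k < N./2)%N ->
  ('C(m - k.+1, k) <= h221 R N m)%N.
Proof.
move=> km kN; rewrite /h221 /hij1 leq_max; apply/orP; right.
have mR : 2 <= m%:R :> R by rewrite (ler_nat R 2); lia.
have /andP[r0 rm] : 0 < r21 R m <= m%:R.
  rewrite /r21; set D := _ + 4; have := sqrtr_ge0 D.
  have : Num.sqrt D <= Num.sqrt ((5 * m%:R) ^+ 2) by rewrite ler_wsqrtr // /D; nra.
  rewrite sqrtr_sqr ger0_norm; last by lra.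
  by rewrite ltr_pdivlMr // ler_pdivrMr //; lra.
(* A positive ceiling makes the index a successor, the form required by [h2_nat]. *)
have: 0 < Num.ceil (r21 R m) by rewrite Num.Theory.ceil_gt_int.
case cE : (Num.ceil _) => [c|//]; rewrite ltz_nat => c0.
have cm : (c <= m)%N by rewrite -lez_nat -cE Num.Theory.ceil_le_int.
rewrite minz_nat; case jE : (minn c N./2) => [|j]; first by lia.
rewrite h2_nat; last by lia.
have [kj|jk] := leqP k j.
  apply: (@le_of_steps (fun r => 'C(m - r.+1, r))%N) => // r /andP[_ rj].
  apply: h2_step_up; first by lia.
  by rewrite pmulrn -Num.Theory.ceil_gt_int cE ltz_nat; lia.
apply: (@ge_of_steps (fun r => 'C(m - r.+1, r))%N); first exact: ltnW.
move=> r /andP[jr rk]; apply: h2_step_down; first by lia.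
by rewrite pmulrn -Num.Theory.ceil_le_int cE lez_nat; lia.
Qed.

(** Both sums collapse by the hockey-stick identity. With [m = d.+1 + e] and [k = d./2], an odd [d]
    gives twice ['C(m - 1 - k, k)], and an even [d] gives ['C(m - k, k) + 'C(m - 1 - k, k - 1)]. *)
Lemma upper_bound_le_Lambda N d e : (0 < d <= N)%N -> (3 <= d.+1 + e)%N ->
  (\sum_(i < d./2.+1) 'C(e + i, i) + \sum_(i < uphalf d) 'C(e + i, i) <=
   Lambda R N (d.+1 + e))%N.
Proof.
move=> /andP[d0 dN] m3; rewrite /Lambda leq_max sum_bin_diag.
have k2 : (d./2 <= N./2)%N by rewrite half_leq.
have := odd_double_half d; set k := d./2 in k2 * => dE.
case od : (odd d) in dE.
  apply/orP; left; have -> : uphalf d = k.+1 by lia.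
  rewrite sum_bin_diag addnn -mul2n leq_mul2l /=.
  have -> : (e + k.+1 = (d.+1 + e).-1 - k)%N by lia.
  by apply: h111_ge => //; lia.
apply/orP; right; case kE : k => [|k']; first by lia.
have -> : uphalf d = k'.+1 by lia.
rewrite sum_bin_diag; apply: leq_add.
  have -> : (e + k'.+2 = d.+1 + e - k'.+1)%N by lia.
  by apply: h111_ge; lia.
have -> : (e + k'.+1 = (d.+1 + e).-1 - k'.+1)%N by lia.
by apply: h221_ge; lia.
Qed.
End Unimodality.

(** * Feasible bases of a linear system *)

Section GenericPoints.
Variables (R : realFieldType) (m : nat).
Implicit Types (u w : 'rV[R]_m) (p q r : 'cV[R]_m).

Lemma perturb (s : seq 'rV[R]_m) p r : exists2 t, 0 < t &
  forall t', 0 < t' <= t -> forall u, u \in s -> (u *m p) 0 0 < 0 ->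
    (u *m (p + t' *: r)) 0 0 < 0.
Proof.
elim: s => [|u s [t t0 IH]]; first by exists 1.
have [up|up] := ltP ((u *m p) 0 0) 0; last first.
  exists t => // t' tt' w; rewrite inE => /predU1P[->|]; last exact: IH.
  by rewrite ltNge up.
set a := (u *m p) 0 0 in up; set c := (u *m r) 0 0.
have c1 : 0 < 1 + `|c| by have := normr_ge0 c; lra.
(* The [1] in the denominator avoids division by zero and makes the change [t' * c] strictly less
   than [- a]. *)
exists (Num.min t (- a / (1 + `|c|))).
  by rewrite lt_min t0 divr_gt0 // oppr_gt0.
move=> t' /andP[t'0]; rewrite le_min => /andP[t't t'a] w.
rewrite inE => /predU1P[->|ws] wp; last by apply: IH; rewrite // t'0.
rewrite mulmxDr -scalemxAr mxE [X in _ + X]mxE -/a -/c.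
move: t'a; rewrite ler_pdivlMr // => t'a.
have := ler_norm c; nra.
Qed.

(** If [w] vanishes at the current point, a small step along [w^T] repairs this, since [w *m w^T] is
    a positive sum of squares, and no earlier strict inequality is lost. *)
Lemma generic_point (s ws : seq 'rV[R]_m) p : exists q,
  (forall u, u \in s -> (u *m p) 0 0 < 0 -> (u *m q) 0 0 < 0) /\
  (forall w, w \in ws -> w != 0 -> (w *m q) 0 0 != 0).
Proof.
elim: ws => [|w ws [q [sq wq]]]; first by exists p.
have [w0|w0] := boolP ((w != 0) && ((w *m q) 0 0 == 0)); last first.
  exists q; split=> // w'; rewrite inE => /predU1P[->|]; last exact: wq.
  by move=> wn; move: w0; rewrite wn.
have [wn /eqP wq0] := andP w0.
(* Listing the negatives as well turns each earlier non-vanishing into a strict inequality that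
   [perturb] preserves. *)
have [t t0 ht] := perturb (s ++ ws ++ [seq - w | w <- ws]) q w^T.
exists (q + t *: w^T); split.
  by move=> u us up; apply: ht; rewrite ?lexx ?t0 ?mem_cat ?us ?sq.
move=> w'; rewrite inE => /predU1P[->|w's] w'n; last first.
  have tt : 0 < t <= t by rewrite t0 lexx.
  have [lt|gt|/eqP e] := ltgtP ((w' *m q) 0 0) 0; last by rewrite (negbTE (wq _ w's w'n)) in e.
    by rewrite lt_eqF // ht // !mem_cat w's orbT.
  have NE x : (- w' *m x) 0 0 = - (w' *m x) 0 0 by rewrite mulNmx mxE.
  rewrite gt_eqF // -oppr_lt0 -NE; apply: ht => //.
    by rewrite !mem_cat map_f ?orbT.
  by rewrite NE oppr_lt0.
rewrite mulmxDr -scalemxAr mxE wq0 add0r mxE.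
apply: mulf_neq0; first by rewrite gt_eqF.
rewrite mxE (eq_bigr (fun i => w 0 i ^+ 2)) => [|i _]; last by rewrite mxE.
rewrite psumr_neq0; last by move=> i _; exact: sqr_ge0.
have [j wj] : exists j, w 0 j != 0.
  by apply/existsP; apply: contraNT wn => /existsPn h; apply/eqP/rowP => j;
     rewrite mxE; apply/eqP; rewrite -[_ == _]negbK; exact: h.
by apply/hasP; exists j; rewrite ?mem_index_enum //= exprn_even_gt0.
Qed.
End GenericPoints.

(** * Bases, pivots and dual solutions *)

Section Bases.
Variables (R : realFieldType) (m d : nat) (A : 'M[R]_(m, d)).
Implicit Types (B S : {set 'I_m}) (G : 'M[R]_(d, m)) (b x : 'cV[R]_m) (c : 'rV[R]_d).

(* [G] is the inverse of the square submatrix of [A] on the rows in [B],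
   padded with zero columns. *)
Definition basis_inverse B G :=
  [/\ G *m A = 1%:M, (forall k j, j \notin B -> G k j = 0) &
      forall i j, i \in B -> j \in B -> (A *m G) i j = (i == j)%:R].

Lemma basis_AG0 B G i j : basis_inverse B G -> j \notin B -> (A *m G) i j = 0.
Proof. by move=> [_ G0 _] jB; rewrite mxE big1 // => k _; rewrite G0 ?mulr0. Qed.

(** [G *m A = 1] and [A *m G] have the same trace, and the diagonal of the latter is the indicator
    of [B]. *)
Lemma basis_card B G : basis_inverse B G -> #|B| = d.
Proof.
move=> bG; have [GA G0 AG] := bG.
have := mxtrace_mulC G A; rewrite GA mxtrace1 /mxtrace (bigID (mem B)) /=.
rewrite [X in _ + X]big1 => [|i iB]; last exact: basis_AG0 bG iB.
rewrite addr0 (eq_bigr (fun=> 1)) => [|i iB]; last by rewrite AG // eqxx.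
by rewrite sumr_const => /eqP; rewrite eqr_nat => /eqP.
Qed.

Lemma basis_G0 B G x : basis_inverse B G -> (forall i, i \in B -> x i 0 = 0) ->
  G *m x = 0.
Proof.
move=> [_ G0 _] x0; apply/colP => k; rewrite !mxE big1 // => i _.
by have [/x0->|/G0->] := boolP (i \in B); rewrite ?mulr0 ?mul0r.
Qed.

Lemma basis_tight B G b i : basis_inverse B G -> i \in B ->
  (A *m (G *m b)) i 0 = b i 0.
Proof.
move=> bG iB; have [_ _ AG] := bG; rewrite mulmxA mxE (bigD1 i) //= AG // eqxx mul1r.
rewrite big1 ?addr0 // => j /negP ji; have [jB|jB] := boolP (j \in B).
  by rewrite AG //; case: eqP => [e|_]; [case: ji; rewrite e|rewrite mul0r].
by rewrite (basis_AG0 _ bG jB) mul0r.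
Qed.

(** The rank-one update clears column [j] of [G] and turns row [k] of [A *m G] into a unit
    vector. *)
Lemma basis_pivot B G j k : basis_inverse B G -> j \in B -> k \notin B ->
  (A *m G) k j != 0 ->
  basis_inverse (k |: B :\ j)
    (G - ((A *m G) k j)^-1 *: (col j G *m (row k (A *m G) - delta_mx 0 k))).
Proof.
move=> bG jB kB Gkj; have [GA G0 AG] := bG.
have AG0 := basis_AG0 _ bG.
have G'E i l : (G - ((A *m G) k j)^-1 *: (col j G *m (row k (A *m G) - delta_mx 0 k))) i l
   = G i l - ((A *m G) k j)^-1 * (G i j * ((A *m G) k l - (l == k)%:R)).
  by rewrite !mxE big_ord1 !mxE eqxx.
have AG'E i l : (A *m (G - ((A *m G) k j)^-1 *: (col j G *m (row k (A *m G) - delta_mx 0 k)))) i l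
   = (A *m G) i l - ((A *m G) k j)^-1 * ((A *m G) i j * ((A *m G) k l - (l == k)%:R)).
  rewrite mulmxBr -scalemxAr colE !mulmxA -colE mxE [X in _ + X]mxE; congr (_ - _).
  rewrite [LHS]mxE; congr (_ * _); rewrite [LHS]mxE big_ord1; congr (_ * _).
    by rewrite [LHS]mxE.
  by rewrite [LHS]mxE [X in X + _]mxE [X in _ + X]mxE [X in - X]mxE eqxx.
split.
- rewrite mulmxBl GA -scalemxAl -mulmxA mulmxBl -row_mul -mulmxA GA mulmx1.
  by rewrite -rowE subrr mulmx0 scaler0 subr0.
- move=> i l; rewrite !inE negb_or negb_and negbK => /andP[lk] /orP[/eqP->|lB].
    rewrite G'E (negbTE (_ : j != k)); last by apply: contraNneq kB => <-.
    by rewrite subr0 mulrCA mulVf // mulr1 subrr.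
  by rewrite G'E [G i l]G0 // [(A *m G) k l]AG0 // (negbTE lk) subr0 !mulr0 subr0.
- move=> i l; rewrite AG'E !inE => /predU1P[->|/andP[ij iB]] lB.
    by rewrite mulrA mulVf // mul1r opprB addrC subrK eq_sym.
  rewrite [(A *m G) i j]AG // (negbTE ij) mul0r mulr0 subr0.
  case/predU1P: lB => [->|/andP[_ lB]]; last by rewrite AG.
  by rewrite AG0 //; case: eqP => // e; move: kB; rewrite -e iB.
Qed.

Lemma basis_inverse_uniq B G1 G2 :
  basis_inverse B G1 -> basis_inverse B G2 -> G1 = G2.
Proof.
move=> b1 b2; have [GA1 G01 _] := b1; have [_ G02 AG2] := b2.
rewrite -[RHS]mul1mx -GA1 -mulmxA; apply/matrixP => k j; rewrite [RHS]mxE.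
have [jB|jB] := boolP (j \in B); last first.
  rewrite G01 // big1 // => i _; by rewrite (basis_AG0 _ b2) ?mulr0.
rewrite (bigD1 j) //= AG2 // eqxx mulr1 big1 ?addr0 // => i /negP ij.
have [iB|iB] := boolP (i \in B); last by rewrite G01 ?mul0r.
by rewrite AG2 //; case: eqP => [e|_]; [case: ij; rewrite e|rewrite mulr0].
Qed.

(** Zeroing the rows outside [T] leaves a matrix of rank [d]; [d] independent rows of it are
    nonzero, hence indexed by [T]. *)
Lemma basis_exists (T : {set 'I_m}) :
  (forall c, exists2 lam : 'rV_m, (forall i, i \notin T -> lam 0 i = 0) & lam *m A = c) ->
  exists2 B : {set 'I_m}, B \subset T & exists G, basis_inverse B G.
Proof.
move=> sp; pose M := \matrix_i (if i \in T then row i A else 0).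
have fM : row_full M.
  rewrite -sub1mx; apply/row_subP => i.
  have [lam lam0 <-] := sp (row i 1%:M).
  suff -> : lam *m A = lam *m M by exact: submxMl.
  rewrite !mulmx_sum_row; apply: eq_bigr => j _; rewrite rowK.
  by case: ifPn => // /lam0 ->; rewrite !scale0r.
have f_inj : injective (fullrankfun fM) by exact: fullrankfun_inj.
have uM := fullrowsub_unit fM; set f := fullrankfun fM in f_inj uM.
have fT l : f l \in T.
  apply/negPn/negP => fl; have /row_freeP[D MD] := fullrowsub_free fM.
  have := congr1 (row l) MD; rewrite row_mul row_rowsub rowK (negbTE fl) mul0mx.
  move=> /matrixP/(_ 0 l); rewrite !mxE eqxx => /eqP; by rewrite eq_sym oner_eq0.
have MA : rowsub f M = rowsub f A.
  by apply/row_matrixP => l; rewrite !row_rowsub rowK fT.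
rewrite MA in uM.
pose D : 'M[R]_(d, m) := \matrix_(l, j) (f l == j)%:R.
have DA : D *m A = rowsub f A.
  apply/matrixP => l k; rewrite !mxE (bigD1 (f l)) //= !mxE eqxx mul1r.
  by rewrite big1 ?addr0 // => i /negP fi; rewrite mxE; case: eqP => [e|_];
    [case: fi; rewrite e|rewrite mul0r].
exists [set f l | l in setT]; first by apply/subsetP => _ /imsetP[l _ ->].
exists (invmx (rowsub f A) *m D); split.
- by rewrite -mulmxA DA mulVmx.
- move=> k j jf; rewrite mxE big1 // => l _; rewrite mxE.
  by case: eqP => [e|_]; [case/imsetP: jf; exists l|rewrite mulr0].
- move=> _ _ /imsetP[l _ ->] /imsetP[l' _ ->].
  rewrite mulmxA.
  have -> : (A *m invmx (rowsub f A) *m D) (f l) (f l') =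
     (rowsub f A *m invmx (rowsub f A) *m D) l (f l').
    rewrite [LHS]mxE [RHS]mxE; apply: eq_bigr => k _; congr (_ * _).
    by rewrite [LHS]mxE [RHS]mxE; apply: eq_bigr => k' _; congr (_ * _); rewrite mxE.
  by rewrite mulmxV // mul1mx mxE (inj_eq f_inj).
Qed.

Definition is_basis B := `[< exists G, basis_inverse B G >].
Definition binv B : 'M[R]_(d, m) :=
  if pselect (exists G, basis_inverse B G) is left ex then projT1 (cid ex) else 0.

Lemma binvP B : is_basis B -> basis_inverse B (binv B).
Proof.
by move=> /asboolP ex; rewrite /binv; case: pselect => // ex'; case: cid.
Qed.

Definition feasible_bases b : {set {set 'I_m}} :=
  [set B | is_basis B && [forall i, (A *m (binv B *m b)) i 0 <= b i 0]].

(** [c *m binv B] is the dual solution at [B]; a negative entry at [j] means that relaxing the tight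
    constraint [j] increases the objective. *)
Definition negative_part c B := [set j in B | (c *m binv B) 0 j < 0].

(** Primal non-degeneracy: only the constraints of [B] are tight at its basic solution, so the
    polyhedron is simple. *)
Definition generic_rhs b := forall B k, is_basis B -> k \notin B ->
  (A *m (binv B *m b)) k 0 != b k 0.

Definition generic_obj c := forall B j, is_basis B -> j \in B ->
  (c *m binv B) 0 j != 0.

Lemma feasibleP b B : reflect
  (is_basis B /\ forall i, (A *m (binv B *m b)) i 0 <= b i 0) (B \in feasible_bases b).
Proof. by rewrite inE; apply: (iffP andP) => -[? /forallP]. Qed.

Lemma obj_value b c B : is_basis B ->
  (c *m (binv B *m b)) 0 0 = \sum_(j in B) (c *m binv B) 0 j * b j 0.
Proof.
move=> bB; have [_ G0 _] := binvP bB; rewrite mulmxA mxE (bigID (mem B)) /=.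
rewrite [X in _ + X]big1 ?addr0 // => j jB.
by rewrite [X in X * _]mxE big1 ?mul0r // => k _; rewrite G0 ?mulr0.
Qed.

Lemma obj_expand c B (x : 'cV_d) : is_basis B ->
  (c *m x : 'M_1) 0 0 = \sum_(j in B) (c *m binv B) 0 j * (A *m x) j 0.
Proof.
move=> bB; have [GA G0 _] := binvP bB.
by rewrite -{1}[x]mul1mx -GA -(mulmxA (binv B)) obj_value.
Qed.

(** * Linear objectives as sink orientations *)

Section Sinks.
Variable b : 'cV[R]_m.
Hypothesis cone : forall c, exists2 lam : 'rV_m, (forall i, 0 <= lam 0 i) & lam *m A = c.
Hypothesis gb : generic_rhs b.

(* A simplex pivot: move along the edge that releases the constraint [j]
   until the first other constraint becomes tight. *)
Lemma improving_pivot c B j : B \in feasible_bases b -> j \in B ->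
  (c *m binv B) 0 j < 0 ->
  exists2 k, k |: B :\ j \in feasible_bases b &
    (c *m (binv B *m b)) 0 0 < (c *m (binv (k |: B :\ j) *m b)) 0 0.
Proof.
move=> /feasibleP[bB fB] jB cj; have bG := binvP bB; have [GA G0 AG] := bG.
set G := binv B in cj fB bG GA G0 AG *; set x := G *m b in fB *.
set u := col j G.
have AuE i : (A *m u) i 0 = (A *m G) i j by rewrite /u colE mulmxA -colE mxE.
have cu : (c *m u) 0 0 < 0 by rewrite /u colE mulmxA -colE mxE.
(* Some constraint blocks the edge: otherwise [A *m u >= 0], and writing [c] as a nonnegative
   combination of rows by [cone] gives [c *m u >= 0]. *)
have [k0 k0u] : exists k, (A *m u) k 0 < 0.
  have [lam lam0 lamA] := cone c.
  apply/existsP; apply: contraLR cu => /existsPn h.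
  rewrite -leNgt -lamA -mulmxA mxE; apply: sumr_ge0 => i _.
  by rewrite mulr_ge0 // leNgt.
pose ratio k := (b k 0 - (A *m x) k 0) / - (A *m u) k 0.
have [k ku kmin] := @arg_minP _ R _ k0 (fun k => (A *m u) k 0 < 0) ratio k0u.
have kB : k \notin B.
  by apply: contraTN ku => kB; rewrite AuE AG // -leNgt ler0n.
(* Genericity of [b] makes the step length positive, hence the improvement strict. *)
have sk : 0 < b k 0 - (A *m x) k 0 by rewrite subr_gt0 lt_neqAle fB andbT gb.
have rk : 0 < ratio k by rewrite divr_gt0 // oppr_gt0.
have Gkj : (A *m G) k j != 0 by rewrite -AuE lt_eqF.
have bG' := basis_pivot bG jB kB Gkj; set G' := _ - _ in bG'.
set B' := k |: B :\ j in bG' *.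
have bB' : is_basis B' by apply/asboolP; exists G'.
have x'E : binv B' *m b = x - ratio k *: u.
  rewrite (basis_inverse_uniq (binvP bB') bG') /G' mulmxBl -/x -scalemxAl -mulmxA.
  congr (_ - _); rewrite mulmxBl -row_mul -mulmxA -/x -rowE.
  rewrite [row k _ - _]mx11_scalar mul_mx_scalar scalerA -/u; congr (_ *: _).
  rewrite /ratio -AuE; set p := (A *m u) k 0; rewrite !mxE; set q := \sum_(_ < _) _.
  by rewrite invrN mulrN -mulNr opprB mulrC.
have Ax'E i : (A *m (binv B' *m b)) i 0 = (A *m x) i 0 - ratio k * (A *m u) i 0.
  by rewrite x'E mulmxBr -scalemxAr mxE [X in _ + X]mxE [X in - X]mxE.
exists k; last first.
  rewrite -/B' x'E mulmxBr -scalemxAr [X in _ < X]mxE [X in _ < _ + X]mxE [X in _ < _ - X]mxE.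
  by rewrite ltrDl oppr_gt0 pmulr_rlt0.
apply/feasibleP; split=> // i; rewrite -/B' Ax'E.
have [iu|iu] := ltP ((A *m u) i 0) 0; last first.
  by rewrite (le_trans _ (fB i)) // gerBl mulr_ge0 // ltW.
have := kmin _ iu; rewrite {2}/ratio ler_pdivlMr ?oppr_gt0 //; lra.
Qed.

(** Take a basis of largest objective value among those containing [S]; a negative entry outside [S]
    would allow an improving pivot that keeps [S]. *)
Lemma exists_optimal c B0 S : B0 \in feasible_bases b -> S \subset B0 ->
  exists2 B, B \in feasible_bases b &
    S \subset B /\ forall j, j \in B -> j \notin S -> 0 <= (c *m binv B) 0 j.
Proof.
move=> fB0 SB0.
pose P := [pred B | (B \in feasible_bases b) && (S \subset B)].
have P0 : P B0 by rewrite /= fB0.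
have [B /andP[fB SB] Bmax] := arg_maxP (fun B => (c *m (binv B *m b)) 0 0) P0.
exists B => //; split=> // j jB jS; rewrite leNgt; apply/negP => cj.
have [k fB' lt] := improving_pivot fB jB cj.
have := Bmax (k |: B :\ j); rewrite /= fB' /= => /(_ _) h.
move: lt; rewrite ltNge => /negP; apply; apply: h.
by rewrite subsetU // subsetD1 SB jS orbT.
Qed.

Lemma optimal_terms c B C S : C \in feasible_bases b -> S \subset C ->
  (forall j, j \in B -> j \notin S -> 0 <= (c *m binv B) 0 j) -> forall j, j \in B ->
  (c *m binv B) 0 j * (A *m (binv C *m b)) j 0 <= (c *m binv B) 0 j * b j 0.
Proof.
move=> /feasibleP[bC fC] SC cB j jB; have [jS|jS] := boolP (j \in S).
  by rewrite (basis_tight _ (binvP bC)) // (subsetP SC).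
by apply: ler_wpM2l => //; exact: cB.
Qed.

(** Complementary slackness: two optima on the face [S] have equal values, whereas an element of [B]
    outside [C] would contribute a positive multiplier times a positive slack. *)
Lemma optimal_sub c B C S : generic_obj c ->
  B \in feasible_bases b -> C \in feasible_bases b -> S \subset B -> S \subset C ->
  (forall j, j \in B -> j \notin S -> 0 <= (c *m binv B) 0 j) ->
  (forall j, j \in C -> j \notin S -> 0 <= (c *m binv C) 0 j) ->
  B \subset C.
Proof.
move=> gc fB fC SB SC cB cC.
have [bB _] := feasibleP _ _ fB; have [bC feC] := feasibleP _ _ fC.
have tB := optimal_terms fC SC cB; have tC := optimal_terms fB SB cC.
have le : (c *m (binv B *m b)) 0 0 <= (c *m (binv C *m b)) 0 0.
  by rewrite (obj_expand _ _ bC) (obj_value _ _ bC); apply: ler_sum.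
rewrite (obj_expand _ (binv C *m b) bB) (obj_value _ _ bB) in le.
apply/subsetP => j jB; apply/negPn/negP => jC.
have : (c *m binv B) 0 j * (A *m (binv C *m b)) j 0 < (c *m binv B) 0 j * b j 0.
  rewrite ltr_pM2l ?lt_neqAle ?feC ?andbT ?gb //.
  rewrite eq_sym gc // cB //; apply: contra jC; exact: (subsetP SC).
apply/negP; rewrite -leNgt.
rewrite (bigD1 j) //= [X in _ <= X](bigD1 j) //= in le.
have := @ler_sum R _ (index_enum _) (fun i => (i \in B) && (i != j)) _ _
  (fun i ij => tB i (andP ij).1).
lra.
Qed.

Lemma negative_part_sub c B S : (negative_part c B \subset S) <->
  (forall j, j \in B -> j \notin S -> 0 <= (c *m binv B) 0 j).
Proof.
split=> [/subsetP h j jB jS|h].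
  by rewrite leNgt; apply: contra jS => cj; apply: h; rewrite inE jB.
apply/subsetP => j; rewrite inE => /andP[jB]; apply: contraTT => jS.
by rewrite -leNgt h.
Qed.

Lemma negative_part_sink c : generic_obj c ->
  sink_orientation (feasible_bases b) (negative_part c).
Proof.
move=> gc; split=> [B _|B0 S fB0 SB0].
  by apply/subsetP => j; rewrite inE => /andP[].
have [B fB [SB cB]] := exists_optimal c fB0 SB0.
apply/eqP/cards1P; exists B; apply/setP => C; rewrite in_set in_set1.
apply/idP/eqP => [|->]; last by rewrite fB SB andbT; apply/negative_part_sub.
move=> /and3P[fC /negative_part_sub cC SC].
apply/eqP; rewrite eqEsubset (optimal_sub gc fC fB SC SB) //.
exact: (optimal_sub gc fB fC SB SC).
Qed.
End Sinks.

Lemma feasible_uniform b : uniform d (feasible_bases b).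
Proof. by move=> B /feasibleP[/binvP/basis_card]. Qed.

Lemma negative_partN c B : generic_obj c -> is_basis B ->
  negative_part (- c) B = B :\: negative_part c B.
Proof.
move=> gc bB; apply/setP => j; rewrite !inE mulNmx mxE oppr_lt0.
case: (boolP (j \in B)) => //= jB.
by rewrite andbT -leNgt lt_neqAle eq_sym gc.
Qed.

Lemma generic_objN c : generic_obj c -> generic_obj (- c).
Proof. by move=> gc B j bB jB; rewrite mulNmx mxE oppr_eq0 gc. Qed.

Lemma eq_sink (V : {set {set 'I_m}}) neg neg' : {in V, neg =1 neg'} ->
  sink_orientation V neg -> sink_orientation V neg'.
Proof.
move=> e [negB sink]; split=> [B BV|B S BV SB]; first by rewrite -e // negB.
rewrite -[RHS](sink B S BV SB); apply: eq_card => C; rewrite !inE.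
by case: (boolP (C \in V)) => //= CV; rewrite e.
Qed.

Lemma coef_functional (lam : 'rV_m) B j :
  (lam *m A *m binv B) 0 j = ((col j (A *m binv B))^T *m lam^T) 0 0.
Proof. by rewrite -trmx_mul [RHS]mxE colE !mulmxA -colE [RHS]mxE. Qed.

(** Genericity of the objective asks that finitely many functionals of the multipliers not vanish.
    Composing with the projection [D] onto the coordinates in [I] keeps the support inside [I]. *)
Lemma generic_combination (I : {set 'I_m}) (p : 'rV[R]_m) (s : seq 'rV[R]_m) :
  (forall c, exists2 lam : 'rV_m, (forall i, i \notin I -> lam 0 i = 0) & lam *m A = c) ->
  (forall i, i \notin I -> p 0 i = 0) ->
  exists lam : 'rV_m, [/\ forall i, i \notin I -> lam 0 i = 0,
    forall u, u \in s -> (u *m p^T) 0 0 < 0 -> (u *m lam^T) 0 0 < 0 &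
    generic_obj (lam *m A)].
Proof.
move=> sp p0.
pose D : 'M[R]_m := diag_mx (\row_i (i \in I)%:R).
have DT : D^T = D by exact: tr_diag_mx.
have restr (l : 'rV[R]_m) : (forall i, i \notin I -> l 0 i = 0) -> l *m D = l.
  move=> l0; apply/rowP => i; rewrite mul_mx_diag !mxE.
  by have [_|/l0->] := boolP (i \in I); rewrite ?mulr1 ?mul0r.
pose w B j := (col j (D *m A *m binv B))^T.
have [q [qs qw]] := generic_point [seq u *m D | u <- s]
  [seq w Bj.1 Bj.2 | Bj : {set 'I_m} * 'I_m] p^T.
exists (q^T *m D); split.
- by move=> i iI; rewrite mul_mx_diag !mxE (negbTE iI) mulr0.
- move=> u us up; rewrite trmx_mul trmxK DT mulmxA.
  apply: qs; first by apply/mapP; exists u.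
  by rewrite -mulmxA -[X in X *m _^T]DT -trmx_mul restr.
- move=> B j bB jB.
  have -> : (q^T *m D *m A *m binv B) 0 j = (w B j *m q) 0 0.
    by rewrite /w -[in RHS](trmxK q) -trmx_mul [RHS]mxE colE !mulmxA -colE [RHS]mxE.
  apply: qw; first by apply/mapP; exists (B, j); rewrite ?mem_enum.
  (* Were [w B j] zero, expressing row [j] of [A] through the rows in [I] would give
     [(A *m binv B) j j = 0] instead of [1]. *)
  apply/negP => /eqP /(congr1 trmx); rewrite trmxK trmx0 => w0.
  have [_ _ AG] := binvP bB.
  have [lam lamI lamA] := sp (row j A).
  have := AG j j jB jB; rewrite eqxx.
  have -> : (A *m binv B) j j = (lam *m (D *m A *m binv B)) 0 j.
    by rewrite !mulmxA restr // lamA -row_mul [RHS]mxE.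
  have -> : (lam *m (D *m A *m binv B)) 0 j = (lam *m col j (D *m A *m binv B)) 0 0.
    by rewrite colE [in RHS]mulmxA -colE [RHS]mxE.
  by rewrite w0 mulmx0 mxE => /esym/eqP; rewrite oner_eq0.
Qed.

(** * From vertices to feasible bases of a perturbed system *)

Section VertexCount.
Variables (b : 'cV[R]_m).
Hypothesis cone : forall c, exists2 lam : 'rV_m, (forall i, 0 <= lam 0 i) & lam *m A = c.

Lemma generic_obj_near (s : seq 'rV[R]_m) (p : 'rV[R]_m) : exists lam : 'rV_m,
  (forall u, u \in s -> (u *m p^T) 0 0 < 0 -> (u *m lam^T) 0 0 < 0) /\
  generic_obj (lam *m A).
Proof.
have [||lam [_ ? ?]] := @generic_combination [set: 'I_m] p s; last by exists lam.
  by move=> c; have [lam _ <-] := cone c; exists lam => // i; rewrite inE.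
by move=> i; rewrite inE.
Qed.

(** For row [j] itself as objective, the dual solution at any basis containing [j] has entry [1] at
    [j]; a nearby generic objective keeps these entries positive. *)
Lemma exists_generic_top j : exists2 c, generic_obj c &
  forall B, is_basis B -> j \in B -> j \notin negative_part c B.
Proof.
have [lam [hs gc]] := generic_obj_near
  [seq - (col j (A *m binv B))^T | B : {set 'I_m}] (delta_mx 0 j).
exists (lam *m A) => // B bB jB; rewrite inE jB /= -leNgt ltW //.
rewrite coef_functional -oppr_lt0.
have NE x : ((- (col j (A *m binv B))^T) *m x : 'M_1) 0 0 = - ((col j (A *m binv B))^T *m x) 0 0.
  by rewrite mulNmx mxE.
rewrite -NE; apply: hs; first by apply/mapP; exists B; rewrite ?mem_enum.
have [_ _ AG] := binvP bB.
by rewrite NE trmx_delta -colE oppr_lt0 3![X in 0 < X]mxE AG // eqxx ltr01.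
Qed.

Lemma feasible_bases_bound b' : (0 < d)%N -> generic_rhs b' ->
  feasible_bases b' != set0 ->
  exists2 e, m = (d.+1 + e)%N &
  (#|feasible_bases b'| <= \sum_(i < d./2.+1) 'C(e + i, i) +
     \sum_(i < uphalf d) 'C(e + i, i))%N.
Proof.
move=> d0 gb V0.
have [lam [_ gc]] := generic_obj_near [::] 0; set c := lam *m A in gc.
have sn := negative_part_sink cone gb gc.
have sn' : sink_orientation (feasible_bases b') (fun B => B :\: negative_part c B).
  apply: eq_sink (negative_part_sink cone gb (generic_objN gc)) => B /feasibleP[bB _].
  exact: negative_partN.
have top j : exists2 neg', sink_orientation (feasible_bases b') neg' &
     forall B, B \in feasible_bases b' -> j \in B -> j \notin neg' B.
  have [c' gc' jc'] := exists_generic_top j.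
  exists (negative_part c'); first exact: negative_part_sink.
  by move=> B /feasibleP[bB _]; apply: jc'.
have uV := @feasible_uniform b'.
have := dim_lt_ground d0 uV sn sn' top V0; rewrite card_ord => dm.
exists (m - d.+1)%N; first by lia.
by apply: (upper_bound uV sn sn' top V0); rewrite card_ord; lia.
Qed.

Variables (n : nat) (v : 'I_n -> 'cV[R]_d).
Hypothesis v_inj : injective v.
Hypothesis v_feas : forall k i, (A *m v k) i 0 <= b i 0.
(** The algebraic form of being a vertex: the rows tight at [v k] span all functionals. *)
Hypothesis v_span : forall k c, exists2 lam : 'rV_m,
  (forall i, (A *m v k) i 0 != b i 0 -> lam 0 i = 0) & lam *m A = c.

Let tight k := [set i | (A *m v k) i 0 == b i 0].

Lemma tight_basis_vertex k B : is_basis B -> B \subset tight k -> binv B *m b = v k.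
Proof.
move=> bB BT; have [GA _ _] := binvP bB.
rewrite -[v k]mul1mx -GA -mulmxA; apply/eqP; rewrite -subr_eq0 -mulmxBr; apply/eqP.
apply: basis_G0 (binvP bB) _ => i /(subsetP BT); rewrite inE => /eqP e.
by rewrite mxE [X in _ + X]mxE e subrr.
Qed.

(** The sum of the tight rows supports the polyhedron at [v k]; a generic choice of weights near it
    stays positive. *)
Lemma supporting_objective k : exists lam : 'rV_m,
  [/\ forall i, i \in tight k -> 0 < lam 0 i, forall i, i \notin tight k -> lam 0 i = 0 &
   generic_obj (lam *m A)].
Proof.
have [||lam [l0 lp gc]] := @generic_combination (tight k)
  (\row_i (i \in tight k)%:R) [seq - delta_mx 0 i | i : 'I_m].
- by move=> c; have [lam l0 <-] := v_span k c; exists lam => // i; rewrite inE; apply: l0.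
- by move=> i; rewrite mxE => /negbTE ->.
exists lam; split=> // i iT; rewrite -oppr_lt0.
have E (p : 'rV[R]_m) : (- delta_mx 0 i *m p^T : 'M_1) 0 0 = - p 0 i.
  by rewrite mulNmx -rowE mxE [X in - X]mxE mxE.
rewrite -E; apply: lp; first by apply/mapP; exists i; rewrite ?mem_enum.
by rewrite E mxE iT oppr_lt0 ltr01.
Qed.

(* If [B] is optimal for an objective exposing [v k] but not all of [B] is
   tight at [v k], weak duality is violated by a fixed margin, which survives
   small changes of [b]. *)
Lemma duality_gap k (lam : 'rV_m) B : is_basis B ->
  (forall i, i \notin tight k -> lam 0 i = 0) ->
  (forall j, j \in B -> 0 < (lam *m A *m binv B) 0 j) ->
  ~~ (B \subset tight k) ->
  ((lam - lam *m A *m binv B) *m b) 0 0 < 0.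
Proof.
move=> bB l0 yB /subsetPn[j jB jT].
rewrite mulmxBl mxE [X in _ + X]mxE subr_lt0.
have -> : (lam *m b) 0 0 = (lam *m A *m v k) 0 0.
  rewrite -mulmxA !mxE; apply: eq_bigr => i _.
  have [|/l0->] := boolP (i \in tight k); last by rewrite !mul0r.
  by rewrite inE => /eqP ->.
rewrite -[_ *m binv B *m b]mulmxA (obj_value _ _ bB) (obj_expand _ _ bB).
rewrite (bigD1 j) //= [X in _ < X](bigD1 j) //=; apply: ltr_leD.
  by rewrite ltr_pM2l ?yB // lt_neqAle v_feas andbT; rewrite inE in jT.
by apply: ler_sum => i /andP[iB _]; rewrite ler_pM2l ?yB.
Qed.

(** [phi k] is an optimal basis at [b'] for an objective supporting at [v k]; [duality_gap], carried
    over to [b'], forces it into [tight k]. *)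
Lemma perturbed_rhs : (0 < n)%N -> exists b', generic_rhs b' /\
  exists phi : 'I_n -> {set 'I_m}, forall k,
    phi k \in feasible_bases b' /\ phi k \subset tight k.
Proof.
move=> n0; have k0 : 'I_n := Ordinal n0.
have /choice [lam lamP] := supporting_objective.
pose u kB := lam kB.1 - lam kB.1 *m A *m binv kB.2.
pose us := [seq u kB | kB : 'I_n * {set 'I_m}].
have [|B0 B0T exG] := @basis_exists (tight k0).
  by move=> c; have [l l0 <-] := v_span k0 c; exists l => // i; rewrite inE; apply: l0.
have bB0 : is_basis B0 by apply/asboolP.
(* Loosening every constraint outside [B0] makes them all slack at the basic solution of [B0], so
   that [B0] survives the passage to a generic [b'] as a feasible starting basis. *)
pose r : 'cV[R]_m := \col_i (i \notin B0)%:R.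
have [t t0 ht] := perturb us b r.
set b1 := b + t *: r in ht.
pose slack B k := row k (A *m binv B) - delta_mx 0 k.
have slackE B k (x : 'cV_m) : (slack B k *m x) 0 0 = (A *m (binv B *m x)) k 0 - x k 0.
  by rewrite mulmxBl -row_mul -rowE mxE [X in X + _]mxE [X in _ + X]mxE [X in _ - X]mxE -mulmxA.
have [b' [us' ws']] := generic_point (us ++ [seq slack B0 k | k : 'I_m])
  [seq slack Bk.1 Bk.2 | Bk : {set 'I_m} * 'I_m] b1.
have gb' : generic_rhs b'.
  move=> B k bB kB; rewrite -subr_eq0 -slackE; apply: ws'.
    by apply/mapP; exists (B, k); rewrite ?mem_enum.
  apply/eqP => /rowP/(_ k); rewrite !mxE !eqxx => /eqP.
  have := basis_AG0 k (binvP bB) kB; rewrite mxE => ->.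
  by rewrite sub0r oppr_eq0 oner_eq0.
have fB0 : B0 \in feasible_bases b'.
  apply/feasibleP; split=> // k; have [kB|kB] := boolP (k \in B0).
    by rewrite (basis_tight _ (binvP bB0)).
  rewrite -subr_le0 -slackE ltW //; apply: us'.
    by rewrite mem_cat; apply/orP; right; apply/mapP; exists k; rewrite ?mem_enum.
  have r0 : binv B0 *m r = 0.
    by apply: basis_G0 (binvP bB0) _ => i iB; rewrite mxE iB.
  rewrite slackE mulmxDr -scalemxAr r0.
  rewrite scaler0 addr0 (tight_basis_vertex bB0 B0T) !mxE kB mulr1.
  by have := v_feas k0 k; rewrite mxE; lra.
exists b'; split=> //.
suff /choice[phi phiP] : forall k, exists B : {set 'I_m},
    B \in feasible_bases b' /\ B \subset tight k by exists phi.
move=> k; have [lp l0 gc] := lamP k.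
have [B fB [_ yB]] := exists_optimal cone gb' (lam k *m A) fB0 (sub0set B0).
exists B; split=> //; have [bB feB] := feasibleP _ _ fB.
apply/negPn/negP => BT.
have lamu : ((lam k - lam k *m A *m binv B) *m b') 0 0 < 0.
  have uus : u (k, B) \in us by apply/mapP; exists (k, B); rewrite ?mem_enum.
  apply: (us' (u (k, B))); first by rewrite mem_cat uus.
  apply: ht => //; first by rewrite t0 lexx.
  apply: duality_gap BT => // j jB; rewrite lt_neqAle eq_sym gc //=.
  by apply: yB => //; rewrite inE.
(* Feasibility of [B] at [b'] and the nonnegativity of [lam k] give the opposite inequality. *)
move: lamu; apply/negP; rewrite -leNgt mulmxBl mxE [X in _ + X]mxE subr_ge0.
rewrite -2!mulmxA mxE [X in _ <= X]mxE; apply: ler_sum => i _.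
have [iT|/l0->] := boolP (i \in tight k); last by rewrite !mul0r.
by apply: ler_wpM2l; [rewrite ltW ?lp|rewrite -mulmxA feB].
Qed.

(** [phi] is injective because a basis tight at [v k] determines [v k]. *)
Lemma vertex_count_bound : (0 < d)%N -> (0 < n)%N ->
  exists2 e, m = (d.+1 + e)%N &
  (n <= \sum_(i < d./2.+1) 'C(e + i, i) + \sum_(i < uphalf d) 'C(e + i, i))%N.
Proof.
move=> d0 n0; have [b' [gb [phi phiP]]] := perturbed_rhs n0.
have phi_inj : injective phi.
  move=> k l e; apply: v_inj.
  have [fk Tk] := phiP k; have [_ Tl] := phiP l; have [bB _] := feasibleP _ _ fk.
  by rewrite -(tight_basis_vertex bB Tk) e (tight_basis_vertex _ Tl) // -e.
have [|e mE le] := feasible_bases_bound d0 gb.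
  by apply/set0Pn; exists (phi (Ordinal n0)); apply: (phiP _).1.
exists e => //; apply: leq_trans le.
rewrite -[X in (X <= _)%N]card_ord -(card_imset _ phi_inj); apply: subset_leq_card.
by apply/subsetP => _ /imsetP[k _ ->]; apply: (phiP k).1.
Qed.
End VertexCount.
End Bases.

From mathcomp Require Import classical_sets.

(** * Facet inequalities of a polytope *)

Section ConeDecomposition.
Variables (R : realFieldType) (K D : nat) (X : 'M[R]_(K, D)).
Hypothesis X_inj : forall g : 'cV_D, X *m g = 0 -> g = 0.
Implicit Types g h : 'cV[R]_D.

Definition valid_functional g := forall k, 0 <= (X *m g) k 0.

(** Zero rows replace the points that are not tight, so that the rank is the dimension of the span
    of the tight ones. *)
Definition tight_mx g := \matrix_k (if (X *m g) k 0 == 0 then row k X else 0).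

Lemma tight_mulP g h :
  tight_mx g *m h = 0 <-> (forall k, (X *m g) k 0 = 0 -> (X *m h) k 0 = 0).
Proof.
have E k : (tight_mx g *m h) k 0 = if (X *m g) k 0 == 0 then (X *m h) k 0 else 0.
  have -> : (tight_mx g *m h) k 0 = (row k (tight_mx g) *m h) 0 0 by rewrite -row_mul [RHS]mxE.
  by rewrite rowK; case: ifP => _; rewrite ?mul0mx -?row_mul mxE.
split=> [t0 k gk|t0]; first by have := E k; rewrite t0 gk eqxx [LHS]mxE => <-.
apply/colP => k; rewrite E [RHS]mxE.
by case: eqP => [e|//]; apply: t0.
Qed.

(** [g] vanishes on the span of its tight rows but not on row [k], so row [k] is new to the span. *)
Lemma tight_rank_lt g h k : (forall k, (X *m g) k 0 = 0 -> (X *m h) k 0 = 0) ->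
  (X *m h) k 0 = 0 -> (X *m g) k 0 != 0 -> (\rank (tight_mx g) < \rank (tight_mx h))%N.
Proof.
move=> gh hk gk.
have le : (tight_mx g <= tight_mx h)%MS.
  apply/row_subP => i; rewrite rowK; case: eqP => [/gh hi|_]; last exact: sub0mx.
  by have := row_sub i (tight_mx h); rewrite rowK hi eqxx.
apply: rank_ltmx; rewrite ltmxE le /=; apply/negP => ge.
have /submxP[Y Yk] : (row k X <= tight_mx g)%MS.
  by apply: submx_trans ge; have := row_sub k (tight_mx h); rewrite rowK hk eqxx.
have /negP := gk; apply; have -> : (X *m g) k 0 = (row k X *m g) 0 0 by rewrite -row_mul [RHS]mxE.
by rewrite Yk -mulmxA (_ : tight_mx g *m g = 0) ?mulmx0 ?mxE //; apply/tight_mulP.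
Qed.

Lemma ker_col_exists m (M : 'M[R]_(m, D)) g : ((\rank M).+1 < D)%N ->
  exists h, M *m h = 0 /\ forall s, h != s *: g.
Proof.
move=> rM.
have : ~~ (kermx M^T <= g^T)%MS.
  apply/negP => /mxrankS; rewrite mxrank_ker !mxrank_tr.
  have : (\rank g <= 1)%N by exact: rank_leq_col.
  lia.
move=> /row_subPn[i ni]; exists (row i (kermx M^T))^T; split.
  by apply: trmx_inj; rewrite trmx_mul trmxK -row_mul mulmx_ker row0 trmx0.
move=> s; apply: contra ni => /eqP /(congr1 trmx); rewrite trmxK => ->.
by rewrite linearZ scalemx_sub.
Qed.

Lemma ker_col_line m (M : 'M[R]_(m, D)) g h : (0 < D)%N -> \rank M = D.-1 ->
  M *m g = 0 -> M *m h = 0 -> h != 0 -> exists s, g = s *: h.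
Proof.
move=> D0 rM Mg Mh h0.
have kE (x : 'cV_D) : M *m x = 0 -> (x^T <= kermx M^T)%MS.
  by move=> Mx; apply/sub_kermxP; rewrite -trmx_mul Mx trmx0.
have rh : \rank h^T = 1%N.
  apply/eqP; rewrite eqn_leq rank_leq_row lt0n mxrank_eq0.
  by apply: contra h0 => /eqP /(congr1 trmx); rewrite trmxK trmx0 => ->.
have /andP[_ ge] : (h^T == kermx M^T)%MS.
  have := mxrank_leqif_eq (kE _ Mh); rewrite rh mxrank_ker mxrank_tr rM => -[_ <-].
  by apply/eqP; lia.
have /sub_rVP[s sE] := submx_trans (kE _ Mg) ge.
by exists s; apply: trmx_inj; rewrite sE linearZ.
Qed.

Variables (m : nat) (phi : 'I_m -> 'cV[R]_D).
Hypothesis facet_functional : forall g, valid_functional g -> g != 0 ->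
  \rank (tight_mx g) = D.-1 -> exists i s, 0 <= s /\ g = s *: phi i.

(* A valid functional whose tight points span too little can be tilted in two
   opposite directions until a new point becomes tight, and is a positive
   combination of the two resulting functionals. *)
Lemma cone_decomposition g : valid_functional g ->
  exists lam : 'I_m -> R, (forall i, 0 <= lam i) /\ g = \sum_i lam i *: phi i.
Proof.
have [n] := ubnP (D - \rank (tight_mx g)); elim: n g => // n IH g ltn vg.
have [->|g0] := eqVneq g 0.
  by exists (fun=> 0); split=> //; rewrite big1 // => i _; rewrite scale0r.
have tg : tight_mx g *m g = 0 by apply/tight_mulP.
have rD : (\rank (tight_mx g) < D)%N.
  rewrite ltn_neqAle rank_leq_col andbT; apply: contra g0 => rD.
  have /row_fullP[Y YT] : row_full (tight_mx g) by [].
  by rewrite -[g]mul1mx -YT -mulmxA tg mulmx0.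
have [rE|rN] := eqVneq (\rank (tight_mx g)) D.-1.
  have [i [s [s0 ->]]] := facet_functional vg g0 rE.
  exists (fun j => if j == i then s else 0); split=> [j|]; first by case: ifP.
  by rewrite (bigD1 i) //= eqxx big1 ?addr0 // => j /negbTE ->; rewrite scale0r.
have [|h [/tight_mulP Mh hN]] := @ker_col_exists _ (tight_mx g) g; first by lia.
have [k kg] : exists k, (X *m g) k 0 != 0.
  apply/existsP; apply: contraNT g0 => /existsPn Xg; apply/eqP/X_inj/colP => k.
  by rewrite [RHS]mxE; apply/eqP; have := Xg k; rewrite negbK.
(* At the extreme ratios, [ratio k1 *: g - h] and [h - ratio k0 *: g] remain valid and each gains a
   tight point; their sum is a multiple of [g]. *)
pose ratio k := (X *m h) k 0 / (X *m g) k 0.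
have gpos j : (X *m g) j 0 != 0 -> 0 < (X *m g) j 0 by move=> j0; rewrite lt_neqAle eq_sym j0 vg.
have [k1 k1g max1] := @arg_maxP _ R _ k (fun k => (X *m g) k 0 != 0) ratio kg.
have [k0 k0g min0] := @arg_minP _ R _ k (fun k => (X *m g) k 0 != 0) ratio kg.
have {}max1 j : (X *m g) j 0 != 0 -> ratio j <= ratio k1 by exact: max1.
have {}min0 j : (X *m g) j 0 != 0 -> ratio k0 <= ratio j by exact: min0.
have rE j : (X *m g) j 0 != 0 -> (X *m h) j 0 = ratio j * (X *m g) j 0.
  by move=> j0; rewrite /ratio mulfVK.
have lin s t j : (X *m (s *: g + t *: h)) j 0 = s * (X *m g) j 0 + t * (X *m h) j 0.
  by rewrite mulmxDr -!scalemxAr mxE [X in X + _]mxE [X in _ + X]mxE.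
(* Equal extremes would make [h] a multiple of [g]. *)
have s01 : ratio k0 < ratio k1.
  rewrite lt_neqAle (max1 _ k0g) andbT; apply/eqP => s01.
  have /negP := hN (ratio k1); apply; rewrite -subr_eq0; apply/eqP/X_inj/colP => j.
  rewrite addrC -scaleNr -[X in _ + X]scale1r lin [RHS]mxE mul1r.
  have [j0|j0] := eqVneq ((X *m g) j 0) 0; first by rewrite Mh // j0 mulr0 addr0.
  have : ratio j = ratio k1 by apply/eqP; rewrite eq_le (max1 _ j0) -s01 (min0 _ j0).
  by rewrite rE // => ->; rewrite mulNr addrC subrr.
have red s t j : s * (X *m g) j 0 + t * (X *m h) j 0 = 0 -> (X *m g) j 0 != 0 ->
    (forall i, (X *m g) i 0 != 0 -> 0 <= s * (X *m g) i 0 + t * (X *m h) i 0) ->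
    exists lam : 'I_m -> R, (forall i, 0 <= lam i) /\
      s *: g + t *: h = \sum_i lam i *: phi i.
  move=> st0 j0 st; apply: IH.
    have := @tight_rank_lt g (s *: g + t *: h) j; rewrite lin => /(_ _ st0 j0) lt.
    suff : (\rank (tight_mx g) < \rank (tight_mx (s *: g + t *: h)))%N by lia.
    by apply: lt => i gi; rewrite lin gi Mh // !mulr0 addr0.
  move=> i; rewrite lin; have [gi|] := eqVneq ((X *m g) i 0) 0; last exact: st.
  by rewrite gi Mh // !mulr0 addr0.
have [||i i0|l1 [l1p l1E]] := red (ratio k1) (-1) k1; rewrite ?mulN1r ?rE ?subrr //.
  by rewrite -mulrBl mulr_ge0 ?vg // subr_ge0 max1.
have [||i i0|l0 [l0p l0E]] := red (- ratio k0) 1 k0; rewrite ?mul1r ?rE ?mulNr ?addNr //.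
  by rewrite addrC -mulrBl mulr_ge0 ?vg // subr_ge0 min0.
have s0 : 0 < ratio k1 - ratio k0 by rewrite subr_gt0.
exists (fun i => (ratio k1 - ratio k0)^-1 * (l1 i + l0 i)); split=> [i|].
  by apply: mulr_ge0; [rewrite invr_ge0 ltW|apply: addr_ge0].
transitivity ((ratio k1 - ratio k0)^-1 *: (\sum_i l1 i *: phi i + \sum_i l0 i *: phi i)).
  rewrite -l1E -l0E addrACA -!scalerDl addNr scale0r addr0 scalerA mulVf ?scale1r //.
  by rewrite gt_eqF.
rewrite -big_split scaler_sumr; apply: eq_bigr => i _ /=.
by rewrite -scalerDl scalerA.
Qed.
End ConeDecomposition.

Lemma dotpE (R : realType) N (a x : 'rV[R]_N) : dotp a x = (x *m a^T) 0 0.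
Proof. by rewrite mxE; apply: eq_bigr => i _; rewrite mxE mulrC. Qed.

Lemma entryD (R : realType) (x y : 'M[R]_1) : (x + y) 0 0 = x 0 0 + y 0 0.
Proof. by rewrite mxE. Qed.

Lemma entryN (R : realType) (x : 'M[R]_1) : (- x) 0 0 = - x 0 0.
Proof. by rewrite mxE. Qed.

(** * Affine coordinates on the affine hull *)

Section Coordinates.
Variables (R : realType) (N d : nat) (P : set 'rV[R]_N) (p : 'I_d.+1 -> 'rV[R]_N).
Hypothesis Pp : forall i, P (p i).
Hypothesis p_indep : aff_indep p.
Hypothesis P_dim : ~ affdim_ge P d.+1.

Definition frame : 'M[R]_(d, N) := \matrix_(i < d) (p (lift ord0 i) - p ord0).
Definition fcoord (x : 'rV[R]_N) : 'rV[R]_d := (x - p ord0) *m pinvmx frame.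
(** Homogeneous coordinates, in which affine functions on the hull become linear functionals;
    [functional a b] represents the slack [b - dotp a x]. *)
Definition hcoord (x : 'rV[R]_N) : 'rV[R]_(1 + d) := row_mx 1%:M (fcoord x).

Definition functional (a : 'rV[R]_N) (b : R) : 'cV[R]_(1 + d) :=
  col_mx (b - dotp a (p ord0))%:M (- (frame *m a^T)).

Lemma frame_free : row_free frame. Proof. exact: p_indep. Qed.

(** Otherwise [x] appended to [p] would be affinely independent, against the maximality of [d]. *)
Lemma frame_sub x : P x -> (x - p ord0 <= frame)%MS.
Proof.
move=> Px; apply/negPn/negP => nx; apply: P_dim.
exists (fun i => if unlift ord_max i is Some j then p j else x); split.
  by move=> i; case: unliftP => [j _|_].
apply: inj_row_free => u.
rewrite mulmx_sum_row big_ord_recr /= rowK.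
have -> : lift ord0 (ord_max : 'I_d.+1) = ord_max by apply: val_inj.
rewrite unlift_none.
have q0 : unlift ord_max (ord0 : 'I_d.+2) = Some (ord0 : 'I_d.+1).
  by rewrite [ord0](_ : _ = lift ord_max (ord0 : 'I_d.+1)) ?liftK //; apply: val_inj.
rewrite q0 => u0.
pose u' := \row_i u 0 (widen_ord (leqnSn d) i).
have sE : u' *m frame + u 0 ord_max *: (x - p ord0) = 0.
  rewrite -[RHS]u0; congr (_ + _); rewrite mulmx_sum_row; apply: eq_bigr => i _.
  rewrite !rowK mxE; congr (_ *: _).
  have -> : lift ord0 (widen_ord (leqnSn d) i) = lift ord_max (lift ord0 i).
    by apply: val_inj; rewrite /= /bump /=; have := ltn_ord i; lia.
  by rewrite liftK.
have um : u 0 ord_max = 0.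
  apply/eqP/negPn/negP => um; move/negP: nx; apply.
  have -> : x - p ord0 = (- (u 0 ord_max)^-1 *: u') *m frame.
    have /eqP := sE; rewrite addrC addr_eq0 => /eqP e.
    by rewrite -scalemxAl scaleNr -scalerN -e scalerA mulVf // scale1r.
  exact: submxMl.
move: sE; rewrite um scale0r addr0 => /eqP; rewrite (mulmx_free_eq0 _ frame_free) => /eqP u'0.
apply/rowP => i; rewrite [RHS]mxE; case: (unliftP ord_max i) => [j ->|-> //].
have /rowP/(_ j) := u'0; rewrite !mxE => <-; congr (u 0 _); apply: val_inj.
exact: lift_max.
Qed.

Lemma fcoordK x : P x -> fcoord x *m frame = x - p ord0.
Proof. by move=> Px; rewrite mulmxKpV // frame_sub. Qed.

Lemma fcoord_inj x y : P x -> P y -> fcoord x = fcoord y -> x = y.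
Proof. by move=> /fcoordK ex /fcoordK ey e; apply: (addIr (- p ord0)); rewrite -ex -ey e. Qed.

Lemma functionalE a b x : P x -> (hcoord x *m functional a b) 0 0 = b - dotp a x.
Proof.
move=> Px; rewrite mul_row_col mul1mx mulmxN mulmxA fcoordK // mulmxBl.
by rewrite entryD entryN entryD entryN -!dotpE mxE eqxx mulr1n; lra.
Qed.

Lemma functional_exists (g : 'cV[R]_(1 + d)) :
  exists a b, forall x, (hcoord x *m g) 0 0 = b - dotp a x.
Proof.
pose a := - (pinvmx frame *m dsubmx g)^T.
exists a, (usubmx g 0 0 + dotp a (p ord0)) => x.
rewrite -[g in LHS]vsubmxK mul_row_col mul1mx entryD -addrA; congr (_ + _).
rewrite /fcoord -mulmxA mulmxBl entryD entryN !dotpE /a.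
by rewrite linearN /= trmxK !mulmxN !entryN; lra.
Qed.

Lemma hcoord_sum k (c : 'I_k -> R) (y : 'I_k -> 'rV[R]_N) : \sum_i c i = 1 ->
  hcoord (\sum_i c i *: y i) = \sum_i c i *: hcoord (y i).
Proof.
move=> c1; rewrite /hcoord.
transitivity (row_mx (\sum_i c i *: 1%:M) (\sum_i c i *: fcoord (y i)) : 'rV[R]_(1 + d)).
  congr row_mx; first by rewrite -scaler_suml c1 scale1r.
  rewrite /fcoord (eq_bigr (fun i => (c i *: y i - c i *: p ord0) *m pinvmx frame)).
    by rewrite -mulmx_suml sumrB -scaler_suml c1 scale1r.
  by move=> i _; rewrite scalemxAl scalerBr.
elim/big_rec3: _ => [|i x y' z _ <-]; first by rewrite row_mx0.
by rewrite scale_row_mx add_row_mx.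
Qed.

Lemma hcoord0 : hcoord (p ord0) = row_mx 1%:M 0.
Proof. by rewrite /hcoord /fcoord subrr mul0mx. Qed.

Lemma hcoord_lift i : hcoord (p (lift ord0 i)) = row_mx 1%:M (delta_mx 0 i).
Proof.
have -> : p (lift ord0 i) = p ord0 + row i frame by rewrite rowK addrC subrK.
by rewrite /hcoord /fcoord addrAC subrr add0r -row_mul mulmxVp ?frame_free // rowE mulmx1.
Qed.

Lemma hcoord_span (g : 'cV[R]_(1 + d)) : (forall i, (hcoord (p i) *m g) 0 0 = 0) -> g = 0.
Proof.
move=> g0; have := g0 ord0.
rewrite -[g]vsubmxK hcoord0 mul_row_col mul1mx mul0mx addr0 => u0.
have {}u0 : usubmx g = 0 by apply/colP => i; rewrite ord1 u0 mxE.
rewrite u0; suff -> : dsubmx g = 0 by rewrite col_mx0.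
apply/colP => i; have := g0 (lift ord0 i).
rewrite -{1}[g]vsubmxK hcoord_lift mul_row_col mul1mx u0 add0r -rowE [LHS]mxE => ->.
by rewrite mxE.
Qed.

Lemma aff_indep_hcoord k (q : 'I_k.+1 -> 'rV[R]_N) : (forall i, P (q i)) ->
  aff_indep q <-> row_free (\matrix_i hcoord (q i)).
Proof.
move=> Pq; split=> ind; apply: inj_row_free => u.
  rewrite mulmx_sum_row => u0.
  have [s0 c0] : \sum_i u 0 i = 0 /\ \sum_i u 0 i *: fcoord (q i) = 0.
    have E : \sum_i u 0 i *: row i (\matrix_i hcoord (q i)) =
       row_mx (\sum_i u 0 i)%:M (\sum_i u 0 i *: fcoord (q i)).
      rewrite (eq_bigr (fun i => row_mx (u 0 i)%:M (u 0 i *: fcoord (q i)))).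
        elim/big_rec3: _ => [|i x y z _ ->]; first by rewrite raddf0 row_mx0.
        by rewrite add_row_mx raddfD.
      by move=> i _; rewrite rowK /hcoord scale_row_mx scale_scalar_mx mulr1.
    move: u0; rewrite E => /eqP; rewrite row_mx_eq0 => /andP[/eqP u0 /eqP c0].
    by split=> //; have /matrixP/(_ 0 0) := u0; rewrite !mxE eqxx mulr1n.
  have sq : \sum_i u 0 i *: q i = 0.
    have := congr1 (mulmx^~ frame) c0; rewrite /= mul0mx mulmx_suml => {}c0.
    rewrite -[RHS]c0 [RHS](eq_bigr (fun i => u 0 i *: q i - u 0 i *: p ord0)) => [|i _].
      by rewrite sumrB -scaler_suml s0 scale0r subr0.
    by rewrite -scalemxAl fcoordK // scalerBr.
  have u'0 : (\row_i u 0 (lift ord0 i)) = 0 :> 'rV_k.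
    apply/eqP; rewrite -(mulmx_free_eq0 _ ind); apply/eqP.
    rewrite mulmx_sum_row -[RHS]sq big_ord_recl.
    move: s0; rewrite big_ord_recl => /eqP; rewrite addr_eq0 => /eqP ->.
    rewrite scaleNr scaler_suml addrC -sumrB; apply: eq_bigr => i _.
    by rewrite rowK mxE scalerBr.
  have u0i i : u 0 (lift ord0 i) = 0 by have /rowP/(_ i) := u'0; rewrite !mxE.
  apply/rowP => i; rewrite [RHS]mxE; case: (unliftP ord0 i) => [j ->|->]; first exact: u0i.
  by move: s0; rewrite big_ord_recl big1 ?addr0 // => j _; rewrite u0i.
rewrite mulmx_sum_row => u0.
(* The coefficient at [ord0] makes the total weight zero, as the leading [1] of [hcoord] demands. *)
pose w : 'rV[R]_k.+1 := \row_i oapp (fun j => u 0 j) (- \sum_j u 0 j) (unlift ord0 i).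
suff /eqP : w *m \matrix_i hcoord (q i) = 0.
  rewrite (mulmx_free_eq0 _ ind) => /eqP/rowP w0; apply/rowP => i.
  by have := w0 (lift ord0 i); rewrite !mxE liftK.
rewrite mulmx_sum_row big_ord_recl mxE unlift_none /= rowK scaleNr scaler_suml addrC -sumrB.
rewrite (eq_bigr (fun i => row_mx 0 ((u 0 i *: (q (lift ord0 i) - q ord0)) *m pinvmx frame))).
  transitivity (row_mx 0 ((\sum_i u 0 i *: (q (lift ord0 i) - q ord0)) *m pinvmx frame)
      : 'rV[R]_(1 + d)).
    elim/big_rec2: _ => [|i x y _ ->]; first by rewrite mul0mx row_mx0.
    by rewrite add_row_mx addr0 mulmxDl.
  rewrite (eq_bigr (fun i => u 0 i *: row i (\matrix_i (q (lift ord0 i) - q ord0)))) ?u0.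
    by rewrite mul0mx row_mx0.
  by move=> i _; rewrite rowK.
move=> i _; rewrite rowK mxE liftK /= /hcoord !scale_row_mx opp_row_mx add_row_mx subrr.
by rewrite /fcoord -scalerBr -mulmxBl opprB addrA subrK scalemxAl.
Qed.
End Coordinates.

(** * The inequality system of a polytope given by its facets *)

Section PolytopeFacets.
Variables (R : realType) (N d K m : nat) (v : 'I_K -> 'rV[R]_N) (p : 'I_d.+2 -> 'rV[R]_N).
Let P := conv_hull v.
Hypothesis Pp : forall i, P (p i).
Hypothesis p_indep : aff_indep p.
Hypothesis P_dim : ~ affdim_ge P d.+2.
Variable f : 'I_m -> set 'rV[R]_N.
Hypothesis f_facet : forall i, facet P (f i).
Hypothesis f_all : forall F, facet P F -> exists i, F = f i.

Local Notation hc := (hcoord p).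

(** The rows are the generators of [P], which may include points that are not vertices. *)
Definition vertex_mx : 'M[R]_(K, 1 + d.+1) := \matrix_k hc (v k).
Local Notation X := vertex_mx.

Lemma gen_in k : P (v k).
Proof.
exists (fun i => (i == k)%:R); split; first by move=> i; rewrite ler0n.
split; first by rewrite (bigD1 k) //= eqxx big1 ?addr0 // => i /negbTE ->.
rewrite (bigD1 k) //= eqxx scale1r big1 ?addr0 // => i /negbTE ->; exact: scale0r.
Qed.

Lemma vertex_mxE k (g : 'cV_(1 + d.+1)) : (X *m g) k 0 = (hc (v k) *m g) 0 0.
Proof. by rewrite -(rowK (fun k => hc (v k))) -row_mul [RHS]mxE. Qed.

Lemma hcoord_conv (g : 'cV_(1 + d.+1)) x : P x -> exists c : 'I_K -> R,
  [/\ forall k, 0 <= c k, \sum_k c k = 1 &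
   (hc x *m g) 0 0 = \sum_k c k * (X *m g) k 0].
Proof.
move=> [c [c0 [c1 ->]]]; exists c; split=> //.
rewrite (hcoord_sum p v c1) mulmx_suml summxE; apply: eq_bigr => k _.
by rewrite -scalemxAl mxE vertex_mxE.
Qed.

Lemma valid_on (g : 'cV_(1 + d.+1)) x : valid_functional X g -> P x -> 0 <= (hc x *m g) 0 0.
Proof.
move=> vg /(hcoord_conv g)[c [c0 _ ->]].
by apply: sumr_ge0 => k _; rewrite mulr_ge0.
Qed.

Lemma vertex_mx_inj (g : 'cV_(1 + d.+1)) : X *m g = 0 -> g = 0.
Proof.
move=> Xg; apply: (hcoord_span p_indep) => i.
have [c [_ _ ->]] := hcoord_conv g (Pp i).
by rewrite big1 // => k _; rewrite Xg mxE mulr0.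
Qed.

(** Independent tight rows provide [d.+1] affinely independent points of the face; [d.+2] such
    points would span the whole space and force [g = 0]. *)
Lemma facet_of_functional g : valid_functional X g -> g != 0 ->
  \rank (tight_mx X g) = d.+1 -> facet P (P `&` [set x | (hc x *m g) 0 0 = 0])%classic.
Proof.
move=> vg g0 rg; have [a [b gE]] := functional_exists p g; split.
  exists a, b; split=> [x Px|]; first by rewrite -subr_ge0 -gE valid_on.
  by apply/seteqP; split=> x [Px /=]; rewrite gE => e; split=> //=; lra.
exists d; split; split => //; first by exists p.
  have rg' : d.+1 = \rank (tight_mx X g) by rewrite rg.
  pose r := maxrankfun (tight_mx X g).
  have free_r : row_free (rowsub r (tight_mx X g)) by exact: maxrowsub_free.
  have tr i : (X *m g) (r i) 0 = 0.
    apply/eqP/negPn/negP => /negbTE ri; have /row_freeP[Y YE] := free_r.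
    have := congr1 (row i) YE; rewrite row_mul row_rowsub rowK ri mul0mx.
    by move=> /rowP/(_ i); rewrite !mxE eqxx => /eqP; rewrite eq_sym oner_eq0.
  exists (fun i => v (r (cast_ord rg' i))).
  have tv i : P (v (r (cast_ord rg' i))) by exact: gen_in.
  split; first by move=> i; split; [exact: tv|rewrite /= -vertex_mxE].
  apply/(aff_indep_hcoord Pp p_indep P_dim tv); apply: inj_row_free => u uE.
  have : castmx (erefl, rg') u *m rowsub r (tight_mx X g) = 0.
    rewrite -[RHS]uE !mulmx_sum_row.
    rewrite (reindex _ (onW_bij _ (Bijective (cast_ordK rg') (cast_ordKV rg')))) /=.
    apply: eq_bigr => i _; rewrite row_rowsub !rowK tr eqxx castmxE /=.
    by rewrite cast_ordK cast_ord_id.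
  move=> /eqP; rewrite (mulmx_free_eq0 _ free_r) => /eqP/rowP u0.
  apply/rowP => i; have := u0 (cast_ord rg' i).
  by rewrite castmxE /= cast_ordK cast_ord_id !mxE.
move=> [q [Fq /(aff_indep_hcoord Pp p_indep P_dim (fun i => (Fq i).1)) fr]].
move/negP: g0; apply; apply/eqP.
have /row_fullP[Y YE] : row_full (\matrix_i hc (q i) : 'M_d.+2).
  by rewrite row_full_unit -row_free_unit.
rewrite -[g]mul1mx -YE -mulmxA (_ : _ *m g = 0) ?mulmx0 //.
apply/colP => i; rewrite [RHS]mxE -[RHS](Fq i).2.
by rewrite -[in RHS](rowK (fun i => hc (q i))) -row_mul [RHS]mxE.
Qed.

Lemma facet_functionals : exists phi : 'I_m -> 'cV[R]_(1 + d.+1),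
  forall i, [/\ valid_functional X (phi i), phi i != 0 &
    f i = (P `&` [set x | (hc x *m phi i) 0 0 = 0])%classic].
Proof.
suff /choice[phi phiP] : forall i, exists g : 'cV[R]_(1 + d.+1),
   [/\ valid_functional X g, g != 0 &
    f i = (P `&` [set x | (hc x *m g) 0 0 = 0])%classic] by exists phi.
move=> i; have [[a [b [ab fE]]] [e [[Pe _] [_ Fe]]]] := f_facet i.
exists (functional p a b).
have E x : P x -> (hc x *m functional p a b) 0 0 = b - dotp a x.
  exact: functionalE.
have fiE : f i = (P `&` [set x | (hc x *m functional p a b) 0 0 = 0])%classic.
  by rewrite fE; apply/seteqP; split=> x [Px /=]; have := E x Px => -> ?; split=> //=; lra.
split=> // [k|].
  by rewrite vertex_mxE E ?subr_ge0 ?ab //; exact: gen_in.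
(* A zero functional would make the facet equal to [P], which has larger dimension. *)
apply/eqP => g0; apply: Fe; suff -> : f i = P by [].
rewrite fiE g0; apply/seteqP; split=> [x [] //|x Px]; split=> //=.
by rewrite mulmx0 mxE.
Qed.

Section FacetSystem.
Variable phi : 'I_m -> 'cV[R]_(1 + d.+1).
Hypothesis phiP : forall i, [/\ valid_functional X (phi i), phi i != 0 &
  f i = (P `&` [set x | (hc x *m phi i) 0 0 = 0])%classic].

(** [g] and [phi i] both vanish on the tight rows, whose common kernel is a line; a generator off
    the facet fixes the sign of the factor. *)
Lemma functional_of_facet g : valid_functional X g -> g != 0 ->
  \rank (tight_mx X g) = (1 + d.+1).-1 -> exists i s, 0 <= s /\ g = s *: phi i.
Proof.
move=> vg g0 rg; have [i fE] := f_all (facet_of_functional vg g0 rg).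
have [vi i0 fiE] := phiP i; exists i.
have tg : tight_mx X g *m g = 0 by apply/tight_mulP.
have ti : tight_mx X g *m phi i = 0.
  apply/tight_mulP => k; rewrite !vertex_mxE => gk.
  have : f i (v k) by rewrite -fE; split; [exact: gen_in|].
  by rewrite fiE => -[].
have [s gE] := ker_col_line (isT : (0 < 1 + d.+1)%N) rg tg ti i0.
exists s; split=> //.
have [k kn] : exists k, (X *m phi i) k 0 != 0.
  apply/existsP; apply: contraNT i0 => /existsPn Xi; apply/eqP/vertex_mx_inj/colP => k.
  by rewrite [RHS]mxE; apply/eqP; have := Xi k; rewrite negbK.
have kp : 0 < (X *m phi i) k 0 by rewrite lt_neqAle eq_sym kn vi.
by have := vg k; rewrite gE -scalemxAr mxE pmulr_lge0.
Qed.

Lemma functional_decomposition g : valid_functional X g ->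
  exists lam : 'I_m -> R, (forall i, 0 <= lam i) /\ g = \sum_i lam i *: phi i.
Proof. exact: (cone_decomposition (@vertex_mx_inj) functional_of_facet). Qed.

Definition facet_normals : 'M[R]_(m, d.+1) := \matrix_i (- (dsubmx (phi i))^T).
Definition facet_rhs : 'cV[R]_m := \col_i usubmx (phi i) 0 0.

Lemma facet_slack x i :
  facet_rhs i 0 - (facet_normals *m (fcoord p x)^T) i 0 = (hc x *m phi i) 0 0.
Proof.
rewrite -[phi i in RHS]vsubmxK mul_row_col mul1mx entryD mxE; congr (_ + _).
move: (fcoord p x) => c; rewrite [in LHS]mxE [in RHS]mxE -sumrN.
by apply: eq_bigr => j _; rewrite !mxE mulNr opprK mulrC.
Qed.

Lemma facet_feasible x i : P x -> (facet_normals *m (fcoord p x)^T) i 0 <= facet_rhs i 0.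
Proof.
by move=> Px; rewrite -subr_ge0 facet_slack valid_on //; have [] := phiP i.
Qed.

Lemma comb_normals (lam : 'I_m -> R) :
  (\row_i lam i) *m facet_normals = - (dsubmx (\sum_i lam i *: phi i))^T.
Proof.
apply/rowP => j; rewrite !mxE summxE -sumrN.
by apply: eq_bigr => i _; rewrite !mxE mulrN.
Qed.

(** As [P] is bounded, [c] is at most some constant on it; decomposing this valid inequality yields
    the multipliers. *)
Lemma facet_normals_cone c : exists2 lam : 'rV_m, (forall i, 0 <= lam 0 i) &
  lam *m facet_normals = c.
Proof.
pose b := \sum_k `|(fcoord p (v k) *m c^T) 0 0|.
pose g : 'cV[R]_(1 + d.+1) := col_mx b%:M (- c^T).
have vg : valid_functional X g.
  move=> k; rewrite vertex_mxE mul_row_col mul1mx mulmxN entryD entryN.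
  rewrite [X in X - _]mxE eqxx mulr1n subr_ge0 (le_trans (ler_norm _)) //.
  by rewrite /b (bigD1 k) //= lerDl sumr_ge0.
have [lam [lam0 gE]] := functional_decomposition vg.
exists (\row_i lam i); first by move=> i; rewrite mxE.
by rewrite comb_normals -gE col_mxKd linearN /= trmxK opprK.
Qed.

(** If [g] exposes [x] and [h] is [c] shifted to vanish at [x], then [g - t *: h] is still valid for
    small [t]. Both decompositions use only facets tight at [x], and their difference divided by [t]
    recovers [c]. *)
Lemma tight_normals_span x : vertex P x -> forall c, exists2 lam : 'rV_m,
  (forall i, (facet_normals *m (fcoord p x)^T) i 0 != facet_rhs i 0 -> lam 0 i = 0) &
  lam *m facet_normals = c.
Proof.
move=> [a [b [ab xE]]] c.
have xin y : P y -> dotp a y = b -> y = x.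
  by move=> Py yb; have : [set x]%classic y by rewrite xE.
have [Px xb] : P x /\ dotp a x = b.
  by have : [set x]%classic x by []; rewrite xE => -[].
pose g := functional p a b.
have gE y : P y -> (hc y *m g) 0 0 = b - dotp a y by exact: functionalE.
have vg : valid_functional X g.
  by move=> k; rewrite vertex_mxE gE ?subr_ge0 ?ab //; exact: gen_in.
pose h : 'cV[R]_(1 + d.+1) := col_mx (- (fcoord p x *m c^T)) c^T.
have hE y : (hc y *m h) 0 0 = (fcoord p y *m c^T) 0 0 - (fcoord p x *m c^T) 0 0.
  by rewrite mul_row_col mul1mx entryD entryN addrC.
have [t t0 ht] := perturb [seq hc (v k) | k : 'I_K] (- g) h.
have vgh : valid_functional X (g - t *: h).
  move=> k; have [vx|vx] := eqVneq (v k) x.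
    rewrite vertex_mxE mulmxBr -scalemxAr vx entryD entryN [X in _ - X]mxE hE subrr.
    by rewrite mulr0 subr0 gE // xb subrr.
  have : (hc (v k) *m (- g + t *: h)) 0 0 < 0.
    apply: ht; rewrite ?t0 ?lexx //; first by apply/mapP; exists k; rewrite ?mem_enum.
    rewrite mulmxN entryN oppr_lt0 gE; last exact: gen_in.
    rewrite subr_gt0 lt_neqAle ab ?andbT; last exact: gen_in.
    by apply: contra_neq vx => /xin; apply; exact: gen_in.
  by rewrite addrC -opprB mulmxN entryN oppr_lt0 vertex_mxE => /ltW.
have [l1 [l10 l1E]] := functional_decomposition vg.
have [l2 [l20 l2E]] := functional_decomposition vgh.
have supp l w : (forall i, 0 <= l i) -> w = \sum_i l i *: phi i -> (hc x *m w) 0 0 = 0 ->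
    forall i, (facet_normals *m (fcoord p x)^T) i 0 != facet_rhs i 0 -> l i = 0.
  move=> l0 -> /eqP; rewrite mulmx_sumr summxE.
  rewrite (eq_bigr (fun i => l i * (hc x *m phi i) 0 0)); last first.
    by move=> i _; rewrite -scalemxAr mxE.
  have ge0 i : 0 <= l i * (hc x *m phi i) 0 0.
    by rewrite mulr_ge0 // valid_on //; have [] := phiP i.
  rewrite psumr_eq0 // => /allP z i ni.
  have := z i (mem_index_enum i); rewrite -facet_slack mulf_eq0 subr_eq0.
  by rewrite [facet_rhs i 0 == _]eq_sym (negbTE ni) orbF => /eqP.
have gx : (hc x *m g) 0 0 = 0 by rewrite gE // xb subrr.
have ghx : (hc x *m (g - t *: h)) 0 0 = 0.
  by rewrite mulmxBr -scalemxAr entryD entryN [X in _ - X]mxE hE subrr mulr0 subr0.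
exists (\row_i (t^-1 * (l2 i - l1 i))).
  by move=> i ni; rewrite mxE (supp _ _ l10 l1E gx) // (supp _ _ l20 l2E ghx) // subrr mulr0.
rewrite comb_normals.
have -> : \sum_i (t^-1 * (l2 i - l1 i)) *: phi i = - h.
  rewrite (eq_bigr (fun i => t^-1 *: (l2 i *: phi i - l1 i *: phi i))) => [|i _]; last first.
    by rewrite -scalerBl scalerA.
  rewrite -scaler_sumr sumrB -l1E -l2E addrAC subrr add0r scalerN scalerA mulVf ?scale1r //.
  by rewrite gt_eqF.
by rewrite /h opp_col_mx col_mxKd linearN /= trmxK opprK.
Qed.

Lemma polytope_vertex_bound n (x : 'I_n -> 'rV[R]_N) : injective x ->
  (forall k, vertex P (x k)) -> (0 < n)%N ->
  exists2 e, m = (d.+2 + e)%N &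
  (n <= \sum_(i < d.+1./2.+1) 'C(e + i, i) + \sum_(i < uphalf d.+1) 'C(e + i, i))%N.
Proof.
move=> x_inj xv n0.
have xP k : P (x k).
  by have [a [b [_ E]]] := xv k; have : [set x k]%classic (x k) by []; rewrite E => -[].
have inj : injective (fun k => (fcoord p (x k))^T).
  move=> k l /(congr1 trmx); rewrite !trmxK => e.
  exact: x_inj (fcoord_inj Pp p_indep P_dim (xP k) (xP l) e).
apply: (vertex_count_bound facet_normals_cone inj (fun k i => facet_feasible i (xP k))) => //.
by move=> k; exact: tight_normals_span.
Qed.
End FacetSystem.
End PolytopeFacets.

Theorem mainTheorem1 (R : realType) (N m n : nat) (P : classical_sets.set 'rV[R]_N) :
  (1 <= N)%N -> (3 <= m)%N ->
  polytope P -> num_facets P m -> num_vertices P n ->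
  (n <= Lambda R N m)%N.
Proof.
move=> _ m3 [K [v ->]] [f [_ [f_facet f_all]]] [x [x_inj [xv _]]].
have [->//|n0] := posnP n.
have m0 : (0 < m)%N by apply: leq_trans m3.
(* Any facet supplies the dimension [d.+1] of the polytope together with an affine frame. *)
have [_ [d [[[p [Pp ip]] dimP] _]]] := f_facet (Ordinal m0).
have [phi phiP] := facet_functionals Pp ip dimP f_facet.
have [e mE le] := polytope_vertex_bound Pp ip dimP f_all phiP x_inj xv n0.
apply: leq_trans le _; rewrite mE; apply: upper_bound_le_Lambda; last by rewrite -mE.
(* The frame consists of [d.+1] independent vectors of length [N], so the dimension is at most
   [N]. *)
by rewrite /= -(eqP (frame_free ip)) rank_leq_col.
Qed.
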